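(* Let $R=R(A,\alpha,v,\rho)$ be a conformal ambiskew polynomial ring over an $\mathbb F$-algebra $A$, where $\mathbb F$ is a field (with associated automorphism $\gamma$), let $u$ be a (fixed) splitting element, let $z=xy-u$ be the Casimir element, and let $S=R_{\mathcal Z}$ be the localization of $R$ at $\mathcal Z=\{z^i\}_{i\geq 0}$. Then $S$ is simple if and only if the following hold: (i) $A$ is $\{\alpha,\gamma\}$-simple; (ii) there do not exist $c\in A$ and $m,j\in\mathbb Z$, with $m$ and $j$ not both $0$, such that $c$ is $(m,j)$-special; (iii) for all $m\geq 1$, there exists $n\geq 0$ such that $u^n\in v^{(m)}A$, where $v^{(m)}:=\sum_{l=0}^{m-1}\rho^{l}\alpha^{l}(v)$.
   Context: Rings are associative with $1$. For an automorphism $\theta$ of a ring $A$, an element $c\in A$ is $\theta$-normal if $ca=\theta(a)c$ for all $a\in A$ and $\theta(c)=c$. An ideal $I$ of $A$ is an $\{\alpha,\gamma\}$-ideal if $\alpha(I)\subseteq I$ and $\gamma(I)\subseteq I$; $A$ is $\{\alpha,\gamma\}$-simple if $0$ and $A$ are its only $\{\alpha,\gamma\}$-ideals. Ambiskew polynomial ring: Let $\mathbb F$ be a field, $A$ an $\mathbb F$-algebra, $\rho\in\mathbb F\setminus\{0\}$, $\gamma$ an $\mathbb F$-automorphism of $A$, $v$ a $\gamma$-normal element of $A$, $\alpha$ an $\mathbb F$-automorphism of $A$ with $\alpha\gamma=\gamma\alpha$, and $\beta:=\alpha^{-1}\gamma$. Extend $\beta$ to an automorphism of $A[y;\alpha]$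 with $\beta(y)=\rho y$; there is a $\beta$-derivation $\delta$ of $A[y;\alpha]$ with $\delta(A)=0$, $\delta(y)=v$. The ambiskew polynomial ring is $R(A,\alpha,v,\rho)=A[y;\alpha][x;\beta,\delta]$; thus $ya=\alpha(a)y$, $xa=\beta(a)x$ ($a\in A$) and $xy=\rho yx+v$. The automorphism $\gamma$ is part of the data. $R$ is conformal if there is a splitting element, i.e. a $\gamma$-normal $u\in A$ with $v=u-\rho\alpha(u)$. Then the Casimir element $z=xy-u=\rho(yx-\alpha(u))$ is normal in $R$: $zy=\rho yz$, $zx=\rho^{-1}xz$, $za=\gamma(a)z$ for $a\in A$. For $m,j\in\mathbb Z$, a non-zero element $c\in A$ is $(m,j)$-special if $\gamma(c)=\rho^m c$, $\alpha(c)=\rho^j c$ and $c$ is $\alpha^m\gamma^{-j}$-normal. *)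

(* Defs.v *)
From HB Require Import structures.
From mathcomp Require Import all_boot all_order all_algebra.

Set Implicit Arguments.
Unset Strict Implicit.
Unset Printing Implicit Defensive.

Import GRing.Theory.
Local Open Scope ring_scope.

Record algAut (F : fieldType) (A : algType F) := AlgAut {
  aut_fun :> {lrmorphism A -> A};
  aut_inv : A -> A;
  aut_funK : cancel aut_fun aut_inv;
  aut_invK : cancel aut_inv aut_fun }.

Definition aut_expz (F : fieldType) (A : algType F) (f : algAut A) (m : int)
    (a : A) : A :=
  match m with
  | Posz n => iter n f a
  | Negz n => iter n.+1 (aut_inv f) a
  end.

Definition two_sided_ideal (R : pzRingType) (I : R -> Prop) : Prop :=
  [/\ I 0,
      forall a b, I a -> I b -> I (a - b)
    & forall r a, I a -> I (r * a) /\ I (a * r)].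

Definition simple_ring (R : pzRingType) : Prop :=
  (1 : R) <> 0 /\
  forall I : R -> Prop, two_sided_ideal I ->
    (forall r, I r -> r = 0) \/ (forall r, I r).

(* algType rings are non-trivial by construction, so A <> 0 is not repeated *)
Definition stable_simple (F : fieldType) (A : algType F)
    (alpha gamma : algAut A) : Prop :=
  forall I : A -> Prop, two_sided_ideal I ->
    (forall a, I a -> I (alpha a)) -> (forall a, I a -> I (gamma a)) ->
    (forall a, I a -> a = 0) \/ (forall a, I a).

Definition normal_elt (A : pzRingType) (theta : A -> A) (c : A) : Prop :=
  (forall a, c * a = theta a * c) /\ theta c = c.

Definition skew_derivation (B : pzRingType) (sigma delta : B -> B) : Prop :=
  (forall a b, delta (a + b) = delta a + delta b) /\
  (forall a b, delta (a * b) = sigma a * delta b + delta a * b).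

(* T = B[x; sigma, delta], with iota the inclusion of B: T is free as a left
   B-module on the powers of x, and x b = sigma(b) x + delta(b).  Here {poly B}
   only serves as the type of finite coefficient sequences, a polynomial p
   standing for the element \sum_i iota p`_i * x ^+ i. *)
Definition ore_extension (F : fieldType) (B : algType F)
    (sigma : algAut B) (delta : B -> B)
    (T : algType F) (iota : {lrmorphism B -> T}) (x : T) : Prop :=
  [/\ skew_derivation sigma delta,
      bijective (fun p : {poly B} => (map_poly iota p).[x])
    & forall b, x * iota b = iota (sigma b) * x + iota (delta b)].

(* The data and a model of R(A, alpha, v, rho) = A[y; alpha][x; beta, delta];
   as usual for Ore extensions, the model is unique up to isomorphism. *)
Record ambiskew (F : fieldType) (A : algType F) (alpha gamma : algAut A)
    (v : A) (rho : F) := Ambiskew {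
  ask_rho_neq0 : rho != 0;
  ask_v_normal : normal_elt gamma v;
  ask_comm : forall a, alpha (gamma a) = gamma (alpha a);
  (* the intermediate ring A[y; alpha] *)
  ask_skew : algType F;
  ask_skew_in : {lrmorphism A -> ask_skew};
  ask_skew_y : ask_skew;
  ask_skewP : ore_extension alpha (fun=> 0) ask_skew_in ask_skew_y;
  (* beta = alpha^-1 gamma on A, extended to A[y; alpha] *)
  ask_beta : algAut ask_skew;
  ask_beta_A : forall a,
    ask_beta (ask_skew_in a) = ask_skew_in (aut_inv alpha (gamma a));
  ask_beta_y : ask_beta ask_skew_y = rho *: ask_skew_y;
  ask_delta : ask_skew -> ask_skew;
  ask_delta_A : forall a, ask_delta (ask_skew_in a) = 0;
  ask_delta_y : ask_delta ask_skew_y = ask_skew_in v;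
  ask_ring :> algType F;
  ask_ring_in : {lrmorphism ask_skew -> ask_ring};
  ask_x : ask_ring;
  ask_ringP : ore_extension ask_beta ask_delta ask_ring_in ask_x }.

Section Casimir.
Variables (F : fieldType) (A : algType F) (alpha gamma : algAut A).
Variables (v : A) (rho : F) (R : ambiskew alpha gamma v rho).

Definition ask_in (a : A) : R := ask_ring_in R (ask_skew_in R a).

Definition ask_y : R := ask_ring_in R (ask_skew_y R).

Definition splitting_elt (u : A) : Prop :=
  normal_elt gamma u /\ v = u - rho *: alpha u.

Definition casimir (u : A) : R := ask_x R * ask_y - ask_in u.

End Casimir.

(* phi exhibits S as the Ore localization of R at the multiplicative set Z *)
Definition localization (R S : pzRingType) (Z : R -> Prop)
    (phi : {rmorphism R -> S}) : Prop :=
  [/\ forall c, Z c -> exists w : S, w * phi c = 1 /\ phi c * w = 1,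
      forall s : S, exists r c, Z c /\ s * phi c = phi r
    & forall r, phi r = 0 <-> exists c, Z c /\ r * c = 0].

Definition powers (R : pzRingType) (z : R) (r : R) : Prop :=
  exists i : nat, r = z ^+ i.

Definition special (F : fieldType) (A : algType F) (alpha gamma : algAut A)
    (rho : F) (m j : int) (c : A) : Prop :=
  [/\ c <> 0,
      gamma c = rho ^ m *: c,
      alpha c = rho ^ j *: c
    & normal_elt (fun a => aut_expz alpha m (aut_expz gamma (- j) a)) c].

Definition v_sum (F : fieldType) (A : algType F) (alpha : algAut A) (v : A)
    (rho : F) (m : nat) : A :=
  \sum_(0 <= l < m) rho ^+ l *: iter l alpha v.

(* Main.v *)
(* Let y, x, z be the usual elements of R.  In R one has za = gamma(a)z,
   zy = rho yz, xz = rho zx, xy = z + u and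
   x y^m = rho^m y^m x + v^(m) y^(m - 1).

   Sufficiency.  A nonzero ideal I of R that is saturated with respect to z meets
   the span P of the monomials a y^k z^l, because every element of R is sent into
   P by a power of y.  The elements p of P with p y^n in I for some n are stable
   under "conjugation" by y and z; in one of minimal support some coefficient can
   be taken to be 1 by (i), and the other coefficients are then special, hence
   zero by (ii).  So I contains a power of y, and (iii) lowers its exponent
   to 0: from y^m one gets v^(m) y^(m-1) and (z + u) y^(m-1), then u^n y^(m-1),
   then z^n y^(m-1).

   Necessity.  An {alpha, gamma}-ideal of A, enlarged so as to be stable under
   the inverse automorphisms, extends to R.  A special c is invertible by (i), and
   after replacing c with its inverse if necessary one obtains a noninvertible
   normal element z^l0 + c y^k z^l.  For (iii), R acts on R/Rx = A[y; alpha], and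
   the ideal generated by y^m maps the whole module into the submodule generated
   by v^(m) y^(m-1) and y^m, while z acts on 1 as - rho alpha(u). *)
Require Import Defs.
From HB Require Import structures.
From mathcomp Require Import all_boot all_order all_algebra.
From Stdlib Require Import Classical.

Set Implicit Arguments.
Unset Strict Implicit.
Unset Printing Implicit Defensive.

Import GRing.Theory.
Local Open Scope ring_scope.

(** * Ore extensions *)

Section Ore.
Variables (F : fieldType) (B : algType F) (sigma : algAut B) (delta : B -> B).
Variables (T : algType F) (iota : {lrmorphism B -> T}) (x : T).
Hypothesis oreT : ore_extension sigma delta iota x.

Let ev (p : {poly B}) : T := (map_poly iota p).[x].

(** The hypothesis [bijective] only asserts that an inverse exists; the boolean equality lets
    [xchoose] select a preimage in [ore_poly]. *)
Lemma ore_surj t : exists p, ev p == t.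
Proof. by case: oreT => _ [g _ gK] _; exists (g t); apply/eqP/gK. Qed.

Definition ore_poly t : {poly B} := xchoose (ore_surj t).

(* [ore_coef t n] is the left coefficient of [x ^+ n] in [t]. *)
Definition ore_coef t n : B := (ore_poly t)`_n.

Lemma ore_polyK t : ev (ore_poly t) = t.
Proof. by apply/eqP/(xchooseP (ore_surj t)). Qed.

Lemma evK p : ore_poly (ev p) = p.
Proof.
by case: oreT => _ evbij _; apply: (bij_inj evbij); apply: ore_polyK.
Qed.

Lemma evD p q : ev (p + q) = ev p + ev q.
Proof. by rewrite /ev rmorphD hornerD. Qed.

Lemma evCM b p : ev (b%:P * p) = iota b * ev p.
Proof. by rewrite /ev rmorphM /= map_polyC hornerCM. Qed.

Lemma evMX p : ev (p * 'X) = ev p * x.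
Proof. by rewrite /ev rmorphM /= map_polyX hornerMX. Qed.

Lemma ore_coefD s t n : ore_coef (s + t) n = ore_coef s n + ore_coef t n.
Proof.
by rewrite -{1}(ore_polyK s) -{1}(ore_polyK t) -evD /ore_coef evK coefD.
Qed.

Lemma ore_coefZ b t n : ore_coef (iota b * t) n = b * ore_coef t n.
Proof. by rewrite -{1}(ore_polyK t) -evCM /ore_coef evK coefCM. Qed.

Lemma ore_coefMX t n : ore_coef (t * x) n.+1 = ore_coef t n.
Proof. by rewrite -{1}(ore_polyK t) -evMX /ore_coef evK coefMX. Qed.

Lemma ore_coefMX0 t : ore_coef (t * x) 0 = 0.
Proof. by rewrite -{1}(ore_polyK t) -evMX /ore_coef evK coefMX. Qed.

Lemma ore_coef0 n : ore_coef 0 n = 0.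
Proof. by have := ore_coefZ 0 0 n; rewrite rmorph0 !mul0r. Qed.

Lemma ore_coefN t n : ore_coef (- t) n = - ore_coef t n.
Proof. by have := ore_coefZ (-1) t n; rewrite rmorphN rmorph1 !mulN1r. Qed.

Lemma ore_coefsc c t n : ore_coef (c *: t) n = c *: ore_coef t n.
Proof.
by have := ore_coefZ (c%:A) t n; rewrite rmorph_alg !mulr_algl.
Qed.

Lemma ore_coef_sum I (r : seq I) (P : pred I) (f : I -> T) n :
  ore_coef (\sum_(i <- r | P i) f i) n = \sum_(i <- r | P i) ore_coef (f i) n.
Proof.
by apply: (big_morph (fun t => ore_coef t n) (fun s t => ore_coefD s t n));
  apply: ore_coef0.
Qed.

Lemma ore_coef1 n : ore_coef 1 n = (n == 0)%N%:R.
Proof.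
have -> : 1 = ev 1%:P by rewrite /ev map_polyC hornerC /= rmorph1.
by rewrite /ore_coef evK coefC; case: n.
Qed.

Lemma ore_coef_in b n : ore_coef (iota b) n = if n == 0%N then b else 0.
Proof.
by rewrite -[iota b]mulr1 ore_coefZ ore_coef1; case: n => [|n];
  rewrite ?mulr1 ?mulr0.
Qed.

Lemma ore_coefXn m n : ore_coef (x ^+ m) n = (n == m)%:R.
Proof.
elim: m n => [|m IHm] n; first by rewrite expr0 ore_coef1.
by case: n => [|n]; rewrite exprSr ?ore_coefMX0 ?ore_coefMX ?IHm.
Qed.

Lemma ore_expand t N : (forall n, (N <= n)%N -> ore_coef t n = 0) ->
  t = \sum_(i < N) iota (ore_coef t i) * x ^+ i.
Proof.
move=> t0; have sz : (size (ore_poly t) <= N)%N by apply/leq_sizeP.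
rewrite -{1}(ore_polyK t) /ev (@horner_coef_wide _ N).
  by apply: eq_bigr => i _; rewrite coef_map.
by apply: leq_trans sz; rewrite size_poly.
Qed.

Lemma ore_finite t : exists N, forall n, (N <= n)%N -> ore_coef t n = 0.
Proof. by exists (size (ore_poly t)); apply/leq_sizeP. Qed.

Lemma ore_ext t : (forall n, ore_coef t n = 0) -> t = 0.
Proof. by move=> t0; rewrite (@ore_expand t 0) ?big_ord0. Qed.

Lemma ore_ind (P : T -> Prop) :
  (forall s t, P s -> P t -> P (s + t)) -> (forall s t, P s -> P t -> P (s * t)) ->
  (forall b, P (iota b)) -> P x -> forall t, P t.
Proof.
move=> PD PM PB Px t; have [N /ore_expand->] := ore_finite t.
apply: big_ind => [|s1 s2|i _]; [by rewrite -(rmorph0 iota); apply: PB |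
  exact: PD | ].
apply: (PM) => //; elim: (i : nat) => [|n IHn];
  first by rewrite expr0 -(rmorph1 iota); apply: PB.
by rewrite exprS; apply: PM.
Qed.

Lemma ore_derivD a b : delta (a + b) = delta a + delta b.
Proof. by case: oreT => -[]. Qed.

Lemma ore_deriv0 : delta 0 = 0.
Proof. by apply: (addrI (delta 0)); rewrite -ore_derivD !addr0. Qed.

Lemma ore_derivM a b : delta (a * b) = sigma a * delta b + delta a * b.
Proof. by case: oreT => -[]. Qed.

Lemma ore_comm b : x * iota b = iota (sigma b) * x + iota (delta b).
Proof. by case: oreT. Qed.

(** Moving [x] past each coefficient gives a shifted term twisted by [sigma] and an unshifted term
    through [delta]. The missing coefficient of index -1 counts as 0. *)
Lemma ore_coefXM t n : ore_coef (x * t) n =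
  sigma (if n is m.+1 then ore_coef t m else 0) + delta (ore_coef t n).
Proof.
have [N tN] := ore_finite t; rewrite {1}(ore_expand tN) mulr_sumr ore_coef_sum.
under eq_bigr => i _ do
  rewrite mulrA ore_comm mulrDl -mulrA -exprS ore_coefD !ore_coefZ !ore_coefXn.
rewrite big_split /=; congr (_ + _).
  case: n => [|n]; first by rewrite big1 ?rmorph0 // => i _; rewrite mulr0.
  under eq_bigr => i _ do rewrite eqSS mulr_natr.
  have [ltnN|leNn] := ltnP n N.
    rewrite (bigD1 (Ordinal ltnN)) //= eqxx mulr1n big1 ?addr0 // => i.
    by rewrite -val_eqE /= eq_sym => /negPf->.
  rewrite tN // rmorph0 big1 // => i _.
  by rewrite gtn_eqF // (leq_trans (ltn_ord i)).
under eq_bigr => i _ do rewrite mulr_natr.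
have [ltnN|leNn] := ltnP n N.
  rewrite (bigD1 (Ordinal ltnN)) //= eqxx mulr1n big1 ?addr0 // => i.
  by rewrite -val_eqE /= eq_sym => /negPf->.
rewrite tN // ore_deriv0 big1 // => i _.
by rewrite gtn_eqF // (leq_trans (ltn_ord i)).
Qed.

(** The coefficient [b] may be zero: [n] only bounds the degree in [x], so products need no
    regularity assumption. *)
Definition ore_top n t b :=
  ore_coef t n = b /\ forall k, (n < k)%N -> ore_coef t k = 0.

Lemma ore_topXn n m t b : ore_top m t b ->
  ore_top (n + m) (x ^+ n * t) (iter n sigma b).
Proof.
move=> tb; elim: n => [|n [IH1 IH2]]; first by rewrite mul1r.
rewrite exprS -mulrA addSn; split=> [|k ltk]; rewrite ore_coefXM.
  by rewrite IH1 IH2 // ore_deriv0 addr0.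
case: k ltk => // k ltk.
by rewrite !IH2 ?ore_deriv0 ?rmorph0 ?addr0 //; apply: ltnW.
Qed.

(** In degrees at least [n + m] only the term [a x^n] of [s] contributes, since [x^i t] has degree
    at most [i + m]. *)
Lemma ore_topM n m s t a b : ore_top n s a -> ore_top m t b ->
  ore_top (n + m) (s * t) (a * iter n sigma b).
Proof.
move=> [sa s0] tb.
suff E k : (n + m <= k)%N ->
    ore_coef (s * t) k = a * ore_coef (x ^+ n * t) k.
  have [e1 e2] := ore_topXn n tb.
  split=> [|k ltk]; first by rewrite E ?e1.
  by rewrite E ?(ltnW ltk) // e2 // mulr0.
move=> lek; rewrite {1}(ore_expand s0) mulr_suml ore_coef_sum big_ord_recr /=.
rewrite -mulrA ore_coefZ sa big1 ?add0r // => i _; rewrite -mulrA ore_coefZ.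
have [_ ->] := ore_topXn i tb; first by rewrite mulr0.
by apply: leq_trans lek; rewrite ltn_add2r.
Qed.

Lemma ore_top_ex t : t <> 0 -> exists n b, b <> 0 /\ ore_top n t b.
Proof.
move=> t0; have [N] := ore_finite t; elim: N => [|N IH] tN.
  by case: t0; apply: ore_ext => n; apply: tN.
have [e|/eqP ne] := eqVneq (ore_coef t N) 0; last by exists N, (ore_coef t N).
by apply: IH => n; rewrite leq_eqVlt => /predU1P[<-//|]; apply: tN.
Qed.

(** If [t] were nonzero, its leading coefficient would be annihilated by a twist of [b]. *)
Lemma ore_rregular m s b : ore_top m s b ->
  (forall a n, a * iter n sigma b = 0 -> a = 0) ->
  forall t, t * s = 0 -> t = 0.
Proof.
move=> sb breg t st0; apply: NNPP => /ore_top_ex[n [a [a0 ta]]].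
by have [] := ore_topM ta sb; rewrite st0 ore_coef0 => /esym/breg.
Qed.

End Ore.

(** * Algebra automorphisms *)

Section Automorphisms.
Variables (F : fieldType) (A : algType F).
Implicit Type f g : algAut A.

Lemma aut_inj f : injective f.
Proof. exact: can_inj (aut_funK f). Qed.

Lemma autV0 f : aut_inv f 0 = 0.
Proof. by apply: (@aut_inj f); rewrite rmorph0 (aut_invK f). Qed.

Lemma autVZ f c a : aut_inv f (c *: a) = c *: aut_inv f a.
Proof. by apply: (@aut_inj f); rewrite linearZ /= !(aut_invK f). Qed.

Lemma autV_comm f g : (forall a, f (g a) = g (f a)) ->
  forall a, g (aut_inv f a) = aut_inv f (g a).
Proof. by move=> fg a; apply: (@aut_inj f); rewrite fg !(aut_invK f). Qed.

Lemma iter_aut0 f n : iter n f 0 = 0.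
Proof. by elim: n => //= n ->; rewrite rmorph0. Qed.

Lemma iter_aut1 f n : iter n f 1 = 1.
Proof. by elim: n => //= n ->; rewrite rmorph1. Qed.

Lemma iter_autD f n : {morph iter n f : a b / a + b}.
Proof. by move=> a b; elim: n => //= n ->; rewrite rmorphD. Qed.

Lemma iter_autN f n : {morph iter n f : a / - a}.
Proof. by move=> a; elim: n => //= n ->; rewrite rmorphN. Qed.

Lemma iter_autM f n : {morph iter n f : a b / a * b}.
Proof. by move=> a b; elim: n => //= n ->; rewrite rmorphM. Qed.

Lemma iter_autZ f n c a : iter n f (c *: a) = c *: iter n f a.
Proof. by elim: n => //= n ->; rewrite linearZ. Qed.

Lemma iter_aut_inj f n : injective (iter n f).
Proof. by move=> a b; elim: n => //= n IH /aut_inj. Qed.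

Lemma iter_autK f n : cancel (iter n (aut_inv f)) (iter n f).
Proof. by move=> a; elim: n => //= n IH; rewrite -iterS iterSr /= (aut_invK f). Qed.

Lemma iter_autVK f n : cancel (iter n f) (iter n (aut_inv f)).
Proof. by move=> a; elim: n => //= n IH; rewrite -iterS iterSr /= (aut_funK f). Qed.

Lemma iter_comm (f g : A -> A) : (forall a, f (g a) = g (f a)) ->
  forall m n a, iter m f (iter n g a) = iter n g (iter m f a).
Proof.
move=> fg m n a; elim: m => //= m ->; elim: n {a} (iter m f a) => //= n IH b.
by rewrite fg IH.
Qed.

Lemma iter_eigen f a c n : f a = c *: a -> iter n f a = c ^+ n *: a.
Proof.
move=> fa; elim: n => [|n /= ->]; first by rewrite expr0 scale1r.
by rewrite linearZ /= fa scalerA exprSr.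
Qed.

Lemma aut_expzB f (m n : nat) a :
  aut_expz f (m%:Z - n%:Z) (iter n f a) = iter m f a.
Proof.
have [le_nm|/ltnW lt_mn] := leqP n m.
  by rewrite subzn //= -iterD subnK.
rewrite -opprB subzn // -{2}(subnK lt_mn) iterD.
by case: (n - m)%N => [|k] //; apply: iter_autVK.
Qed.

Lemma aut_expzV f m a : aut_expz f m (aut_expz f (- m) a) = a.
Proof.
have [p [q ->]] : exists p q : nat, m = p%:Z - q%:Z.
  by case: m => n; [exists n, 0%N | exists 0%N, n.+1]; rewrite ?subr0 ?sub0r.
by rewrite -(iter_autK f p a) opprB !aut_expzB.
Qed.

Lemma aut_expz_comm f g m n : (forall a, f (g a) = g (f a)) ->
  forall a, aut_expz f m (aut_expz g n a) = aut_expz g n (aut_expz f m a).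
Proof.
move=> fg.
have fg' := autV_comm fg.
have gf' a : f (aut_inv g a) = aut_inv g (f a) by apply: autV_comm => b.
have gf'' a : aut_inv f (aut_inv g a) = aut_inv g (aut_inv f a).
  by apply: (@aut_inj f); rewrite gf' !(aut_invK f).
by move=> a; case: m n => m [] n; apply: iter_comm => b;
  rewrite ?fg ?fg' ?gf' ?gf''.
Qed.

Lemma aut_expz_eigen f a (c : F) m : c != 0 -> f a = c *: a ->
  aut_expz f m a = c ^ m *: a.
Proof.
move=> c0 fa; case: m => n; first exact: iter_eigen.
have: iter n.+1 f a = c ^+ n.+1 *: a by apply: iter_eigen.
move/(congr1 (fun b => c ^- n.+1 *: iter n.+1 (aut_inv f) b)).
rewrite iter_autVK => ->.
have VZ k d b : iter k (aut_inv f) (d *: b) = d *: iter k (aut_inv f) b.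
  by elim: k => //= k ->; rewrite autVZ.
by rewrite VZ scalerA mulVf ?scale1r // expf_neq0.
Qed.

End Automorphisms.

(** * Ideals of a localization at a normal element *)

Section Localization.
Variables (R S : pzRingType) (z : R) (phi : {rmorphism R -> S}).
Hypothesis hS : localization (powers z) phi.
Hypothesis z_reg : forall r, r * z = 0 -> r = 0.
Hypothesis z_normr : forall r, exists r', r * z = z * r'.

Lemma zX_reg n r : r * z ^+ n = 0 -> r = 0.
Proof. by elim: n r => [|n IH] r; rewrite ?mulr1 // exprS mulrA => /IH/z_reg. Qed.

Lemma loc_inj r : phi r = 0 -> r = 0.
Proof. by case: hS => _ _ h /h[c [[i ->]]]; apply: zX_reg. Qed.

Lemma loc_zX_unit n : exists w, w * phi (z ^+ n) = 1 /\ phi (z ^+ n) * w = 1.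
Proof. by case: hS => h _ _; apply: h; exists n. Qed.

Lemma loc_den s : exists r n, s * phi (z ^+ n) = phi r.
Proof. by case: hS => _ h _; have [r [_ [[n ->] e]]] := h s; exists r, n. Qed.

(** Fractions over powers of [z] with numerators in [I] form an ideal of [S], because [I z] lies in
    [z I]. It is nonzero, hence contains 1, and this puts a denominator [z^k] in [I]. *)
Lemma simple_loc_power (I : R -> Prop) : simple_ring S -> two_sided_ideal I ->
  (forall r, I r -> exists r', I r' /\ r * z = z * r') ->
  (exists r, I r /\ r <> 0) -> exists n, I (z ^+ n).
Proof.
move=> [_ Ssimple] [I0 IB IM] Iz [r0 [Ir0 r0n0]].
have IzX n r : I r -> exists r', I r' /\ r * z ^+ n = z ^+ n * r'.
  elim: n r => [|n IH] r Ir; first by exists r; rewrite mulr1 mul1r.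
  have [r1 [Ir1 e1]] := IH r Ir; have [r2 [Ir2 e2]] := Iz r1 Ir1.
  by exists r2; rewrite exprSr mulrA e1 -mulrA e2 mulrA.
have norm_zX n r : exists r', r * z ^+ n = z ^+ n * r'.
  elim: n r => [|n IH] r; first by exists r; rewrite mulr1 mul1r.
  have [r1 e1] := IH r; have [r2 e2] := z_normr r1.
  by exists r2; rewrite exprSr mulrA e1 -mulrA e2 mulrA.
pose J s := exists k r, I r /\ s * phi (z ^+ k) = phi r.
have Jideal : two_sided_ideal J.
  split.
  - by exists 0%N, 0; rewrite mul0r rmorph0.
  - move=> s1 s2 [k1 [r1 [I1 e1]]] [k2 [r2 [I2 e2]]].
    exists (k1 + k2)%N, (r1 * z ^+ k2 - r2 * z ^+ k1); split.
      by apply: IB; apply: (IM _ _ _).2.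
    rewrite rmorphB !rmorphM /= -e1 -e2 mulrBl -!mulrA -!rmorphM /= -!exprD.
    by rewrite [(k2 + k1)%N]addnC.
  - move=> s' s [k [r [Ir e]]].
    have [r' [n e']] := loc_den s'; split.
      (* Omitting [phi]: [s' s z^(k+n) = s' r z^n = s' z^n r1 = r' r1]. *)
      have [r1 [Ir1 e1]] := IzX n r Ir.
      exists (k + n)%N, (r' * r1); split; first exact: (IM _ _ Ir1).1.
      by rewrite exprD rmorphM /= mulrA -(mulrA s') e -mulrA -rmorphM e1
                 !rmorphM /= mulrA e'.
    have [r1 e1] := norm_zX k r'.
    exists (n + k)%N, (r * r1); split; first exact: (IM _ _ Ir).2.
    by rewrite exprD rmorphM /= mulrA -(mulrA s) e' -mulrA -rmorphM e1
               !rmorphM /= mulrA e.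
case: (Ssimple J Jideal) => [J0|J1].
  case: r0n0; apply: loc_inj; apply: J0.
  by exists 0%N, r0; rewrite rmorph1 mulr1.
have [k [r [Ir]]] := J1 1; rewrite mul1r => e; exists k.
suff -> : z ^+ k = r by [].
by apply/eqP; rewrite -subr_eq0; apply/eqP/loc_inj; rewrite rmorphB e subrr.
Qed.

(** Ideals of [S] are contracted to [R]. A contraction is saturated because [phi z] is a unit, and
    clearing a denominator keeps an element nonzero. *)
Lemma simple_loc_intro : (1 : R) <> 0 ->
  (forall I : R -> Prop, two_sided_ideal I -> (forall r, I (r * z) -> I r) ->
     (exists r, I r /\ r <> 0) -> I 1) ->
  simple_ring S.
Proof.
move=> R1 h; split=> [S1|I [I0 IB IM]].
  by apply: R1; apply: loc_inj; rewrite rmorph1.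
case: (classic (exists s, I s /\ s <> 0)) => [[s [Is s0]]|nI]; last first.
  by left=> s Is; apply: NNPP => s0; apply: nI; exists s.
right=> t; have [r [n e]] := loc_den s.
suff: I (phi 1) by rewrite rmorph1 => /(IM t)[]; rewrite mulr1.
apply: (h (fun r => I (phi r))).
- split; first by rewrite rmorph0.
  + by move=> a b; rewrite rmorphB; apply: IB.
  + by move=> a b Ib; rewrite !rmorphM; apply: IM.
- move=> r1; have [w [_ zw]] := loc_zX_unit 1.
  by rewrite rmorphM => /(IM w)[_]; rewrite -mulrA -{1}(expr1 z) zw mulr1.
- exists r; split; first by rewrite -e; apply: (IM _ _ Is).2.
  move=> r0; apply: s0; have [w [_ zw]] := loc_zX_unit n.
  by rewrite -(mulr1 s) -zw mulrA e r0 rmorph0 mul0r.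
Qed.

End Localization.

(** * Right ideals spanned by a set *)

Inductive right_span (R : pzRingType) (G : R -> Prop) : R -> Prop :=
| right_span0 : right_span G 0
| right_span_add g r t : G g -> right_span G t -> right_span G (g * r + t).

Section RightSpan.
Variables (R : pzRingType) (G : R -> Prop).

Lemma right_spanD s t : right_span G s -> right_span G t -> right_span G (s + t).
Proof.
move=> Hs Ht; elim: Hs => [|g r s' Gg _ IH]; first by rewrite add0r.
by rewrite -addrA; apply: right_span_add.
Qed.

Lemma right_span_gen g r : G g -> right_span G (g * r).
Proof.
by move=> Gg; rewrite -[g * r]addr0; apply: right_span_add => //;
  apply: right_span0.
Qed.

Lemma right_spanMr s r : right_span G s -> right_span G (s * r).
Proof.
elim=> [|g r' t Gg _ IH]; first by rewrite mul0r; apply: right_span0.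
by rewrite mulrDl -mulrA; apply: right_span_add.
Qed.

Lemma right_spanMl r : (forall g, G g -> right_span G (r * g)) ->
  forall s, right_span G s -> right_span G (r * s).
Proof.
move=> hr s; elim=> [|g r' t Gg _ IH]; first by rewrite mulr0; apply: right_span0.
rewrite mulrDr mulrA; apply: right_spanD => //.
by apply: right_spanMr; apply: hr.
Qed.

Lemma right_span_ideal : (forall r g, G g -> right_span G (r * g)) ->
  two_sided_ideal (right_span G).
Proof.
move=> Gl; split; first exact: right_span0.
  by move=> a b Ha Hb; rewrite -mulrN1; apply: right_spanD => //;
    apply: right_spanMr.
move=> r a Ha; split; last exact: right_spanMr.
by apply: right_spanMl => // g; apply: Gl.
Qed.

Lemma right_span_norm z : (forall r, exists r', r * z = z * r') ->
  (forall g, G g -> exists g', G g' /\ g * z = z * g') ->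
  forall s, right_span G s -> exists s', right_span G s' /\ s * z = z * s'.
Proof.
move=> nz Gz s; elim=> [|g r t Gg _ [t' [Ht' e]]].
  by exists 0; rewrite mul0r mulr0; split=> //; apply: right_span0.
have [r' er] := nz r; have [g' [Gg' eg]] := Gz g Gg.
exists (g' * r' + t'); split; first exact: right_span_add.
by rewrite mulrDl mulrDr e -mulrA er mulrA eg mulrA.
Qed.

End RightSpan.

(** * The Casimir element *)

Section Ambiskew.
Variables (F : fieldType) (A : algType F) (alpha gamma : algAut A).
Variables (v : A) (rho : F) (R : ambiskew alpha gamma v rho).

HB.instance Definition _ := GRing.LRMorphism.copy (ask_in R)
  (ask_ring_in R \o ask_skew_in R).

Local Notation i := (ask_in R).
Local Notation x := (ask_x R).
Local Notation y := (ask_y R).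
Local Notation Y := (ask_skew_y R).
Local Notation inB := (ask_skew_in R).
Local Notation betaB := (@ask_beta _ _ _ _ _ _ R).
Local Notation deltaB := (@ask_delta _ _ _ _ _ _ R).
Local Notation oreB := (ask_skewP R).
Local Notation oreR := (ask_ringP R).

Definition beta a := aut_inv alpha (gamma a).

Lemma alpha_gammaC a : alpha (gamma a) = gamma (alpha a).
Proof. exact: (ask_comm R). Qed.

Lemma alpha_beta a : alpha (beta a) = gamma a.
Proof. exact: (aut_invK alpha). Qed.

Lemma beta_alpha a : beta (alpha a) = gamma a.
Proof. by rewrite /beta -alpha_gammaC (aut_funK alpha). Qed.

Lemma skew_y_in a : Y * inB a = inB (alpha a) * Y.
Proof. by have := ore_comm oreB a; rewrite rmorph0 addr0. Qed.

Lemma y_in a : y * i a = i (alpha a) * y.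
Proof. by rewrite /ask_y /ask_in -!rmorphM skew_y_in. Qed.

Lemma yX_in n a : y ^+ n * i a = i (iter n alpha a) * y ^+ n.
Proof.
elim: n => [|n IH]; first by rewrite mulr1 mul1r.
by rewrite exprS -mulrA IH mulrA y_in -mulrA.
Qed.

Lemma in_yX n a : i a * y ^+ n = y ^+ n * i (iter n (aut_inv alpha) a).
Proof. by rewrite yX_in iter_autK. Qed.

Lemma x_in a : x * i a = i (beta a) * x.
Proof.
by have := ore_comm oreR (inB a); rewrite ask_beta_A ask_delta_A rmorph0 addr0.
Qed.

Lemma x_y : x * y = rho *: (y * x) + i v.
Proof.
have := ore_comm oreR Y.
by rewrite ask_beta_y ask_delta_y linearZ /= -scalerAl.
Qed.

(** Since [A], [y] and [x] generate [R], normality of an element or stability under left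
    multiplication need only be checked on them. *)
Lemma ambiskew_ind (P : R -> Prop) :
  (forall s t, P s -> P t -> P (s + t)) -> (forall s t, P s -> P t -> P (s * t)) ->
  (forall a, P (i a)) -> P y -> P x -> forall r, P r.
Proof.
move=> PD PM PA Py Px; apply: (ore_ind oreR) => //.
apply: (ore_ind oreB) => // s t; rewrite ?rmorphD ?rmorphM; [exact: PD|exact: PM].
Qed.

Lemma betaB_YX m : betaB (Y ^+ m) = rho ^+ m *: Y ^+ m.
Proof. by rewrite rmorphXn /= ask_beta_y exprZn. Qed.

Lemma iter_rho n m : iter n betaB (Y ^+ m) = rho ^+ (n * m) *: Y ^+ m.
Proof.
elim: n => [|n /= ->]; first by rewrite scale1r.
by rewrite linearZ /= betaB_YX scalerA -exprD mulSn addnC.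
Qed.

(** By the skew Leibniz rule each further factor [Y] adds a term
    [rho^l Y^l v = rho^l alpha^l(v) Y^l], which is the next summand of [v_sum]. *)
Lemma skew_delta_yX n :
  deltaB (Y ^+ n.+1) = inB (v_sum alpha v rho n.+1) * Y ^+ n.
Proof.
elim: n => [|n IH].
  by rewrite /v_sum big_nat1 expr0 mulr1 scale1r ask_delta_y.
rewrite exprSr (ore_derivM oreR) IH ask_delta_y -mulrA -exprSr.
rewrite betaB_YX -scalerAl.
have -> : Y ^+ n.+1 * inB v = inB (iter n.+1 alpha v) * Y ^+ n.+1.
  elim: n.+1 => [|k IHk]; first by rewrite mulr1 mul1r.
  by rewrite exprS -mulrA IHk mulrA skew_y_in -mulrA.
rewrite [in RHS]/v_sum big_nat_recr //= -/(v_sum _ _ _ n.+1).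
by rewrite rmorphD /= linearZ /= mulrDl addrC -!scalerAl.
Qed.

Lemma x_yX n : x * y ^+ n.+1 =
  rho ^+ n.+1 *: (y ^+ n.+1 * x) + i (v_sum alpha v rho n.+1) * y ^+ n.
Proof.
have := ore_comm oreR (Y ^+ n.+1); rewrite skew_delta_yX betaB_YX.
by rewrite rmorphM linearZ /= !rmorphXn -scalerAl.
Qed.

(** As a polynomial in [x], [y] is the constant [Y]. The extended [beta] only rescales [Y] by
    nonzero scalars, so right multiplication by its twists stays injective. *)
Lemma y_rregular r : r * y = 0 -> r = 0.
Proof.
have Ytop : ore_top oreR 0 y Y.
  by split=> [|k k0]; rewrite (ore_coef_in oreR) ?eqxx // gtn_eqF.
apply: (ore_rregular Ytop) => a n.
have := iter_rho n 1; rewrite expr1 => ->.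
rewrite -scalerAr => /eqP;
  rewrite scaler_eq0 expf_eq0 (negPf (ask_rho_neq0 R)) andbF /=.
move/eqP => aY; apply: (@ore_ext _ _ _ _ _ _ _ oreB) => k.
by rewrite -(ore_coefMX oreB) aY ore_coef0.
Qed.

Lemma yX_rregular n r : r * y ^+ n = 0 -> r = 0.
Proof. by elim: n r => [|n IH] r; rewrite ?mulr1 // exprSr mulrA =>
  /y_rregular/IH. Qed.

Section Casimir.
Variable u : A.
Hypothesis hu : splitting_elt alpha gamma v rho u.
Local Notation z := (casimir R u).

Lemma gamma_u : gamma u = u.
Proof. by case: hu => -[]. Qed.

Lemma u_norm a : u * a = gamma a * u.
Proof. by case: hu => -[]. Qed.

Lemma vE : v = u - rho *: alpha u.
Proof. by case: hu. Qed.

Lemma in_v : i v = i u - rho *: i (alpha u).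
Proof. by rewrite -linearZ -rmorphB -vE. Qed.

Lemma x_yE : x * y = z + i u.
Proof. by rewrite /casimir subrK. Qed.

Lemma casimirE : z = rho *: (y * x) - rho *: i (alpha u).
Proof.
by rewrite /casimir x_y in_v -addrA addrAC subrr add0r.
Qed.

Lemma z_in a : z * i a = i (gamma a) * z.
Proof.
rewrite /casimir mulrBl mulrBr -mulrA y_in mulrA x_in beta_alpha mulrA.
by rewrite -!rmorphM u_norm.
Qed.

Lemma z_y : z * y = rho *: (y * z).
Proof.
rewrite {2}/casimir mulrBr scalerBr mulrA y_in /casimir mulrBl {1}x_y.
rewrite mulrDl -!scalerAl -addrA; congr (_ + _).
by rewrite in_v mulrBl addrAC subrr add0r -scalerAl.
Qed.

Lemma x_z : x * z = rho *: (z * x).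
Proof.
rewrite {1}casimirE /casimir mulrBr mulrBl -!scalerAr scalerBr -mulrA.
by rewrite [x * (y * x)]mulrA x_in beta_alpha gamma_u.
Qed.

Lemma zX_in n a : z ^+ n * i a = i (iter n gamma a) * z ^+ n.
Proof.
elim: n => [|n IH]; first by rewrite mulr1 mul1r.
by rewrite exprS -mulrA IH mulrA z_in -mulrA.
Qed.

Lemma zX_y n : z ^+ n * y = rho ^+ n *: (y * z ^+ n).
Proof.
elim: n => [|n IH]; first by rewrite mulr1 mul1r scale1r.
by rewrite exprS -mulrA IH -scalerAr [z * (y * _)]mulrA z_y -scalerAl scalerA
  -mulrA -exprSr.
Qed.

Lemma zX_yX n m : z ^+ n * y ^+ m = rho ^+ (n * m) *: (y ^+ m * z ^+ n).
Proof.
elim: m => [|m IH]; first by rewrite muln0 mulr1 mul1r scale1r.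
by rewrite exprSr mulrA IH -scalerAl -[_ * _ * y]mulrA zX_y -scalerAr scalerA
  mulrA -exprD mulnS addnC.
Qed.

Let rho0 : rho != 0 := ask_rho_neq0 R.

Lemma z_normr r : exists r', r * z = z * r'.
Proof.
elim/ambiskew_ind: r => [s t [s' es] [t' et]|s t [s' es] [t' et]|a||].
- by exists (s' + t'); rewrite mulrDl es et mulrDr.
- by exists (s' * t'); rewrite -mulrA et !mulrA es.
- by exists (i (aut_inv gamma a)); rewrite z_in (aut_invK gamma).
- by exists (rho^-1 *: y); rewrite -scalerAr z_y scalerA mulVf ?scale1r.
- by exists (rho *: x); rewrite x_z scalerAr.
Qed.

Lemma z_top : ore_top oreR 1 z (rho *: Y).
Proof.
have E k : ore_coef oreR z k = rho *: (Y * (k == 1)%N%:R) -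
    rho *: (if k == 0%N then inB (alpha u) else 0).
  rewrite casimirE ore_coefD ore_coefN !ore_coefsc ore_coefZ ore_coef_in.
  by have := ore_coefXn oreR 1 k; rewrite expr1 => ->.
split=> [|[|[|k]]] //; rewrite E /= ?mulr1 ?mulr0 ?scaler0 ?subr0 //.
Qed.

(** The leading coefficient of [z] in [x] is [rho Y], and twisting it only produces powers of [rho];
    all that matters later is that the scalar is nonzero. *)
Lemma zX_top n : exists k, k != 0 /\ ore_top oreR n (z ^+ n) (k *: Y ^+ n).
Proof.
elim: n => [|n [k [k0 IH]]].
  exists 1; rewrite oner_eq0 expr0 scale1r; split=> //; split=> [|m m0].
    by rewrite ore_coef1.
  by rewrite ore_coef1 gtn_eqF.
exists (k * (rho * rho ^+ n)); split; first by rewrite !mulf_neq0 ?expf_neq0.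
have := ore_topM IH z_top; rewrite addn1 -exprSr.
have -> // : k *: Y ^+ n * iter n betaB (rho *: Y) =
  k * (rho * rho ^+ n) *: Y ^+ n.+1.
have := iter_rho n 1; rewrite iter_autZ expr1 => ->.
by rewrite muln1 scalerA -scalerAl -scalerAr scalerA exprSr.
Qed.

Lemma skew_yX_rregular n q : q * Y ^+ n = 0 -> q = 0.
Proof.
elim: n q => [|n IH] q; rewrite ?mulr1 // exprSr mulrA => qY; apply: IH.
apply: (@ore_ext _ _ _ _ _ _ _ oreB) => k.
by rewrite -(ore_coefMX oreB) qY ore_coef0.
Qed.

Lemma z_rregular r : r * z = 0 -> r = 0.
Proof.
apply: (ore_rregular z_top) => a n; rewrite iter_autZ.
have := iter_rho n 1; rewrite expr1 => ->.
rewrite -!scalerAr scalerA => /eqP.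
rewrite scaler_eq0 mulf_eq0 expf_eq0 (negPf rho0) andbF /= => /eqP aY.
by apply: (@skew_yX_rregular 1).
Qed.

(** * The monomials [y^k z^l] and their independence over [A] *)

Definition pmon (p : nat * nat) : R := y ^+ p.1 * z ^+ p.2.

(** Exponents may repeat in the list, so that sums become concatenations; [pev_indep] collects like
    terms. *)
Definition pev (s : seq (A * (nat * nat))) : R :=
  \sum_(t <- s) i t.1 * pmon t.2.

(** The system is triangular: the coefficient of the highest power of [x] isolates the last [q],
    times a nonzero multiple of a power of [Y]. *)
Lemma zX_indep N (q : nat -> ask_skew R) :
  \sum_(j < N) ask_ring_in R (q j) * z ^+ j = 0 -> forall j, (j < N)%N -> q j = 0.
Proof.
elim: N => [|N IH] // E.
suff qN : q N = 0.
  move: E; rewrite big_ord_recr /= qN rmorph0 mul0r addr0 => /IH{}IH j.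
  by rewrite ltnS leq_eqVlt => /predU1P[->|/IH].
move/(congr1 (fun t => ore_coef oreR t N)): E.
rewrite ore_coef0 ore_coef_sum big_ord_recr /= big1 => [|j _].
  have [k [k0 [e _]]] := zX_top N.
  rewrite add0r ore_coefZ e -scalerAr => /eqP.
  by rewrite scaler_eq0 (negPf k0) /= => /eqP/skew_yX_rregular.
have [k [_ [_ e]]] := zX_top j.
by rewrite ore_coefZ e ?mulr0.
Qed.

Lemma pev_indep s p : pev s = 0 -> \sum_(t <- s | t.2 == p) t.1 = 0.
Proof.
move=> s0.
pose q j := \sum_(t <- s | t.2.2 == j) inB t.1 * Y ^+ t.2.1.
(* This bound exceeds every exponent of [z] in [s], and [p.2] too. *)
pose N := (\max_(t <- s) t.2.2 + p.2).+1.
have /zX_indep/(_ p.2) : \sum_(j < N) ask_ring_in R (q j) * z ^+ j = 0.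
  rewrite -[RHS]s0 /pev /q.
  under eq_bigr => j _ do rewrite rmorph_sum mulr_suml big_mkcond /=.
  rewrite exchange_big /=; apply: eq_big_seq => t ts.
  have tN : (t.2.2 < N)%N.
    rewrite ltnS; apply: leq_trans (leq_addr _ _).
    by rewrite (big_rem t ts) /= leq_maxl.
  rewrite (bigD1 (Ordinal tN)) //= eqxx big1 ?addr0 => [|j].
    by rewrite /pmon rmorphM rmorphXn mulrA.
  by rewrite -val_eqE /= eq_sym => /negPf->.
rewrite ltnS leq_addl => /(_ isT) /(congr1 (fun b => ore_coef oreB b p.1)).
rewrite ore_coef0 => e; rewrite -[RHS]e /q ore_coef_sum.
rewrite big_mkcond [RHS]big_mkcond /=; apply: eq_bigr => t _.
rewrite ore_coefZ ore_coefXn; case: t => a [k l]; case: p {N e} => k' l' /=.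
rewrite xpair_eqE andbC [k' == k]eq_sym; case: (l == l') => //=.
by case: (k == k'); rewrite ?mulr1 ?mulr0.
Qed.

End Casimir.
End Ambiskew.

(** * Elements of minimal support *)

Section Special.
Variables (F : fieldType) (A : algType F) (alpha gamma : algAut A) (rho : F).
Hypothesis rho0 : rho != 0.
Hypothesis agC : forall a, alpha (gamma a) = gamma (alpha a).

Lemma aut_expzZ (f : algAut A) m c a : aut_expz f m (c *: a) = c *: aut_expz f m a.
Proof.
case: m => n; first exact: iter_autZ.
by rewrite /aut_expz; elim: n.+1 => //= k ->; rewrite autVZ.
Qed.

Lemma expzB (m n : nat) : rho ^ (m%:Z - n%:Z) = rho ^+ m / rho ^+ n.
Proof. by rewrite expfzDr // exprnN. Qed.

Lemma scale_expzB (m n : nat) (a b : A) :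
  a = rho ^ (m%:Z - n%:Z) *: b <-> rho ^+ n *: a = rho ^+ m *: b.
Proof.
rewrite expzB; split=> [->|e].
  by rewrite scalerA mulrCA divff ?mulr1 // expf_neq0.
by rewrite mulrC -scalerA -e scalerA mulVf ?scale1r // expf_neq0.
Qed.

(** Both weights are written as differences of naturals, and normality is evaluated at
    [alpha^k(gamma^l(a))], so that no inverse automorphism or negative power is left. *)
Lemma specialP (k0 k l0 l : nat) c :
  special alpha gamma rho (k0%:Z - k%:Z) (l%:Z - l0%:Z) c <->
  [/\ c <> 0, rho ^+ k *: gamma c = rho ^+ k0 *: c,
      rho ^+ l0 *: alpha c = rho ^+ l *: c
    & forall a, iter k0 alpha (iter l0 gamma a) * c =
                c * iter k alpha (iter l gamma a)].
Proof.
have shift a : aut_expz alpha (k0%:Z - k%:Z)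
    (aut_expz gamma (- (l%:Z - l0%:Z)) (iter k alpha (iter l gamma a))) =
    iter k0 alpha (iter l0 gamma a).
  have := @aut_expz_comm _ _ alpha gamma k (- (l%:Z - l0%:Z)) agC.
  by rewrite /= => <-; rewrite opprB !aut_expzB.
split=> [[c0 /scale_expzB gc /scale_expzB ac [cn _]]|[c0 gc ac cn]].
  by split=> // a; rewrite cn shift.
move/scale_expzB: gc => gc; move/scale_expzB: ac => ac; split=> //; split=> [a|].
  rewrite -(iter_autK alpha k a) -(iter_autK gamma l (iter k _ a)).
  by rewrite shift cn.
(* With [m, j] the two weights, [gamma^-j] scales [c] by [rho^(-mj)] and [alpha^m] by [rho^(jm)];
   the factors cancel. *)
rewrite (aut_expz_eigen _ _ gc) ?expfz_neq0 // aut_expzZ.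
rewrite (aut_expz_eigen _ _ ac) ?expfz_neq0 // scalerA !exprz_exp -expfzDr //.
by rewrite mulrN [(l%:Z - l0%:Z) * _]mulrC addNr expr0z scale1r.
Qed.

Section MinimalSupport.
Variables (T : finType) (k l : T -> nat) (J : {ffun T -> A} -> Prop).
Hypothesis kl_inj : injective (fun t => (k t, l t)).
Hypothesis J_sub : forall f g, J f -> J g -> J (f - g).
Hypothesis J_mull : forall a f, J f -> J [ffun t => a * f t].
Hypothesis J_mulr : forall a f, J f ->
  J [ffun t => f t * iter (k t) alpha (iter (l t) gamma a)].
Hypothesis J_alpha : forall f, J f -> J [ffun t => rho ^- l t *: alpha (f t)].
Hypothesis J_gamma : forall f, J f -> J [ffun t => rho ^+ k t *: gamma (f t)].
Hypothesis A_simple : stable_simple alpha gamma.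
Hypothesis no_special : ~ (exists (c : A) (m j : int),
  ~ (m = 0 /\ j = 0) /\ special alpha gamma rho m j c).

(** The values at [t0] of members of [J] supported within [f0] form a nonzero {alpha, gamma}-ideal,
    so some such [f] has value 1 there. Comparing [f] with its transforms under the closure rules of
    [J] gives differences vanishing at [t0], hence zero; the resulting identities make every other
    nonzero [f t] special. *)
Lemma monomial_of_minimal_support f0 t0 : J f0 -> f0 t0 <> 0 ->
  (forall g : {ffun T -> A}, J g -> (forall t, f0 t = 0 -> g t = 0) ->
     g t0 = 0 -> g = 0) ->
  J [ffun t => (t == t0)%:R].
Proof.
move=> J0 f0t0 fmin.
pose I a := exists f : {ffun T -> A},
  [/\ J f, forall t, f0 t = 0 -> f t = 0 & f t0 = a].
have Iideal : two_sided_ideal I.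
  split.
  - exists (f0 - f0); split; [exact: J_sub | | by rewrite !ffunE subrr].
    by move=> t e; rewrite !ffunE subrr.
  - move=> a b [f [Jf f0f <-]] [g [Jg f0g <-]]; exists (f - g).
    split; [exact: J_sub | | by rewrite !ffunE].
    by move=> t e; rewrite !ffunE f0f ?f0g ?subrr.
  - move=> r a [f [Jf f0f <-]]; split.
      exists [ffun t => r * f t]; split; [exact: J_mull | | by rewrite ffunE].
      by move=> t e; rewrite ffunE f0f ?mulr0.
    (* Chosen so that the twist at [t0] turns [b] back into [r]. *)
    pose b := iter (l t0) (aut_inv gamma) (iter (k t0) (aut_inv alpha) r).
    exists [ffun t => f t * iter (k t) alpha (iter (l t) gamma b)].
    split; [exact: J_mulr | | by rewrite ffunE /b !iter_autK].
    by move=> t e; rewrite ffunE f0f ?mul0r.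
have Ialpha a : I a -> I (alpha a).
  move=> [f [Jf f0f <-]].
  (* The prefactor undoes the scalar that [J_alpha] introduces at [t0]. *)
  exists [ffun t => (rho ^+ l t0)%:A * [ffun t => rho ^- l t *: alpha (f t)] t].
  split; [exact/J_mull/J_alpha | |]; last first.
    by rewrite !ffunE mulr_algl scalerA divff ?scale1r ?expf_neq0.
  by move=> t e; rewrite !ffunE f0f // rmorph0 scaler0 mulr0.
have Igamma a : I a -> I (gamma a).
  move=> [f [Jf f0f <-]].
  exists [ffun t => (rho ^- k t0)%:A * [ffun t => rho ^+ k t *: gamma (f t)] t].
  split; [exact/J_mull/J_gamma | |]; last first.
    by rewrite !ffunE mulr_algl scalerA mulVf ?scale1r ?expf_neq0.
  by move=> t e; rewrite !ffunE f0f // rmorph0 scaler0 mulr0.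
case: (A_simple Iideal Ialpha Igamma) => [I0|I1].
  by case: f0t0; apply: I0; exists f0.
have {I1} [f [Jf f0f ft0]] := I1 1.
have comm a t : iter (k t0) alpha (iter (l t0) gamma a) * f t =
                f t * iter (k t) alpha (iter (l t) gamma a).
  apply/eqP; rewrite -subr_eq0; apply/eqP.
  pose b := iter (k t0) alpha (iter (l t0) gamma a).
  have : [ffun t => b * f t] -
      [ffun t => f t * iter (k t) alpha (iter (l t) gamma a)] = 0.
    apply: fmin; [by apply: J_sub; [apply: J_mull | apply: J_mulr] | |].
      by move=> s e; rewrite !ffunE f0f // mulr0 mul0r subrr.
    by rewrite !ffunE ft0 mulr1 mul1r subrr.
  by move/ffunP/(_ t); rewrite !ffunE.
have fa t : rho ^+ l t0 *: alpha (f t) = rho ^+ l t *: f t.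
  have : [ffun t => rho ^- l t *: alpha (f t)] - [ffun t =>
    (rho ^- l t0)%:A * f t] = 0.
    apply: fmin; [by apply: J_sub; [apply: J_alpha | apply: J_mull] | |].
      by move=> s e; rewrite !ffunE f0f // rmorph0 scaler0 mulr0 subrr.
    by rewrite !ffunE ft0 rmorph1 mulr1 subrr.
  move/ffunP/(_ t); rewrite !ffunE mulr_algl => /eqP; rewrite subr_eq0 => /eqP e.
  have {e} := congr1 (fun a => (rho ^+ l t0 * rho ^+ l t) *: a) e.
  rewrite !scalerA mulfK ?expf_neq0 // => ->.
  by rewrite mulrC mulrA mulVf ?mul1r ?expf_neq0.
have fg t : rho ^+ k t *: gamma (f t) = rho ^+ k t0 *: f t.
  have : [ffun t => rho ^+ k t *: gamma (f t)] - [ffun t =>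
    (rho ^+ k t0)%:A * f t] = 0.
    apply: fmin; [by apply: J_sub; [apply: J_gamma | apply: J_mull] | |].
      by move=> s e; rewrite !ffunE f0f // rmorph0 scaler0 mulr0 subrr.
    by rewrite !ffunE ft0 rmorph1 mulr1 subrr.
  by move/ffunP/(_ t); rewrite !ffunE mulr_algl => /eqP; rewrite subr_eq0 => /eqP.
have -> // : [ffun t => (t == t0)%:R] = f.
apply/ffunP=> t; rewrite ffunE; have [->|/eqP ne] := eqVneq t t0;
  first by rewrite ft0.
apply: NNPP => /nesym ft; case: no_special.
exists (f t), ((k t0)%:Z - (k t)%:Z), ((l t)%:Z - (l t0)%:Z); split; last first.
  by apply/specialP.
case=> /eqP; rewrite subr_eq0 eqz_nat => /eqP ek /eqP.
rewrite subr_eq0 eqz_nat => /eqP el.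
by apply: ne; apply: kl_inj; rewrite ek el.
Qed.

(** Induction on the size of the support: if [f] is not minimal at [t0], some nonzero member of [J]
    is supported on fewer points. *)
Lemma monomial_in_stable f : J f -> f <> 0 -> exists t0, J [ffun t => (t == t0)%:R].
Proof.
have [n] := ubnP #|[set t | f t != 0]|; elim: n f => // n IH f; rewrite ltnS =>
  ltn Jf f0.
have [t0 ft0] : exists t0, f t0 <> 0.
  apply: NNPP => h; apply: f0; apply/ffunP => t; rewrite ffunE.
  by apply: NNPP => ft; apply: h; exists t.
case: (classic (exists g : {ffun T -> A},
    [/\ J g, forall t, f t = 0 -> g t = 0, g t0 = 0 & g <> 0])) =>
      [[g [Jg fg gt0 g0]]|h].
  apply: IH Jg g0; apply: leq_trans ltn; apply: proper_card.
  apply/properP; split.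
    apply/subsetP=> t; rewrite !inE; apply: contra => /eqP/fg->//.
  by exists t0; rewrite !inE ?gt0 ?eqxx //; apply/eqP.
exists t0; apply: (monomial_of_minimal_support Jf ft0) => g Jg fg gt0.
by apply: NNPP => g0; apply: h; exists g.
Qed.

End MinimalSupport.
End Special.

(** * Sufficiency *)

Section Simplicity.
Variables (F : fieldType) (A : algType F) (alpha gamma : algAut A).
Variables (v : A) (rho : F) (R : ambiskew alpha gamma v rho) (u : A).
Hypothesis hu : splitting_elt alpha gamma v rho u.

Local Notation i := (ask_in R).
Local Notation x := (ask_x R).
Local Notation y := (ask_y R).
Local Notation z := (casimir R u).
Local Notation pmon := (pmon R u).
Local Notation pev := (pev R u).
Let rho0 : rho != 0 := ask_rho_neq0 R.

Lemma y_pmon a p : y * (i a * pmon p) = i (alpha a) * pmon (p.1.+1, p.2).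
Proof. by rewrite mulrA y_in /pmon exprS -!mulrA. Qed.

Lemma z_pmon a p :
  z * (i a * pmon p) = i (rho ^+ p.1 *: gamma a) * pmon (p.1, p.2.+1).
Proof.
rewrite mulrA (z_in R hu) /pmon exprS -mulrA [z * (_ * _)]mulrA.
have := zX_yX R hu 1 p.1; rewrite mul1n expr1 => ->.
by rewrite linearZ /= -!scalerAl -scalerAr -!mulrA.
Qed.

Lemma pmon_y a p : i a * pmon p * y = i (rho ^+ p.2 *: a) * pmon (p.1.+1, p.2).
Proof.
by rewrite /pmon -!mulrA (zX_y R hu) -!scalerAr linearZ /= -scalerAl exprSr -!mulrA.
Qed.

Lemma pmon_z a p : i a * pmon p * z = i a * pmon (p.1, p.2.+1).
Proof. by rewrite /pmon -!mulrA -exprSr. Qed.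

Lemma pmon_in a p :
  pmon p * i a = i (iter p.1 alpha (iter p.2 gamma a)) * pmon p.
Proof. by rewrite /pmon -mulrA (zX_in R hu) mulrA yX_in -mulrA. Qed.

(** * The span of the monomials [a y^k z^l] *)

Definition pspan (r : R) := exists s, r = pev s.

Lemma pspan_pmon a p : pspan (i a * pmon p).
Proof. by exists [:: (a, p)]; rewrite /pev big_seq1. Qed.

Lemma pspanD r s : pspan r -> pspan s -> pspan (r + s).
Proof. by move=> [s1 ->] [s2 ->]; exists (s1 ++ s2); rewrite /pev big_cat. Qed.

Lemma pspan_morph (f : R -> R) : {morph f : r s / r + s} ->
  (forall a p, pspan (f (i a * pmon p))) -> forall r, pspan r -> pspan (f r).
Proof.
move=> fD fp r [s ->]; elim: s => [|[a p] s IH].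
  rewrite /pev big_nil; exists nil; rewrite /pev big_nil.
  by apply: (addrI (f 0)); rewrite -fD !addr0.
by rewrite /pev big_cons fD; apply: pspanD.
Qed.

Lemma pspan_inM a r : pspan r -> pspan (i a * r).
Proof.
apply: pspan_morph => [s t|b p]; first by rewrite mulrDr.
by rewrite mulrA -rmorphM; apply: pspan_pmon.
Qed.

Lemma pspan_yM r : pspan r -> pspan (y * r).
Proof.
apply: pspan_morph => [s t|b p]; first by rewrite mulrDr.
by rewrite y_pmon; apply: pspan_pmon.
Qed.

Lemma pspan_zM r : pspan r -> pspan (z * r).
Proof.
apply: pspan_morph => [s t|b p]; first by rewrite mulrDr.
by rewrite z_pmon; apply: pspan_pmon.
Qed.

Lemma pspan_My r : pspan r -> pspan (r * y).
Proof.
apply: (@pspan_morph (fun r => r * y)) => [s t|b p]; first by rewrite mulrDl.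
by rewrite pmon_y; apply: pspan_pmon.
Qed.

(** Moving the final [y] next to [x] costs only a scalar and a twist of the coefficient, and there
    [x y = z + u]. *)
Lemma pspan_xMy r : pspan r -> pspan (x * r * y).
Proof.
apply: (@pspan_morph (fun r => x * r * y)) => [s t|b p].
  by rewrite mulrDr mulrDl.
rewrite -mulrA pmon_y mulrA x_in /pmon exprS -!mulrA [x * _]mulrA (x_yE R u).
rewrite mulrDl; apply: pspan_inM; apply: pspanD.
  by apply: pspan_zM; rewrite -[_ * _]mul1r -(rmorph1 i); apply: pspan_pmon.
by apply: pspan_pmon.
Qed.

Lemma pspan_yX r : exists n, pspan (r * y ^+ n).
Proof.
(* With an arbitrary [p] on the right, the product case works: [t p y^n] is again in the span and
   serves as [p] for [s]. *)
suff : forall p, pspan p -> exists n, pspan (r * p * y ^+ n).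
  move/(_ 1)=> []; last by move=> n; rewrite mulr1; exists n.
  by exists [:: (1, (0, 0)%N)]; rewrite /pev big_seq1 rmorph1 /pmon !mulr1.
have My n p : pspan p -> pspan (p * y ^+ n).
  by elim: n => [|n IH] hp; rewrite ?mulr1 // exprSr mulrA; apply/pspan_My/IH.
elim/ambiskew_ind: r => [s t hs ht|s t hs ht|a||] p hp.
- have [m hm] := hs p hp; have [n hn] := ht p hp; exists (m + n)%N.
  rewrite !mulrDl; apply: pspanD; first by rewrite exprD mulrA; apply: My.
  by rewrite addnC exprD mulrA; apply: My.
- have [n hn] := ht p hp; have [m hm] := hs _ hn; exists (n + m)%N.
  by move: hm; rewrite exprD !mulrA.
- by exists 0%N; rewrite mulr1; apply: pspan_inM.
- by exists 0%N; rewrite mulr1; apply: pspan_yM.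
- by exists 1%N; apply: pspan_xMy.
Qed.

(** Bounding both exponents by [N] makes coefficient families functions on a finite type, as the
    minimal support argument requires. *)
Definition bpos N (t : 'I_N * 'I_N) : nat * nat := (t.1 : nat, t.2 : nat).

Lemma bpos_inj N : injective (@bpos N).
Proof. by move=> [a b] [c d] [/val_inj-> /val_inj->]. Qed.

Definition bev N (f : {ffun 'I_N * 'I_N -> A}) : R :=
  \sum_t i (f t) * pmon (bpos t).

Lemma bevB N : {morph @bev N : f g / f - g}.
Proof.
move=> f g; rewrite /bev -sumrB; apply: eq_bigr => t _.
by rewrite !ffunE rmorphB mulrBl.
Qed.

Lemma pspan_bev r : pspan r -> exists N (f : {ffun 'I_N * 'I_N -> A}), r = bev f.
Proof.
move=> [s ->]; pose N := (\max_(t <- s) maxn t.2.1 t.2.2).+1.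
exists N, [ffun t => \sum_(a <- s | a.2 == bpos t) a.1].
rewrite /bev /pev; under [RHS]eq_bigr => t _ do
  rewrite ffunE rmorph_sum mulr_suml big_mkcond /=.
rewrite exchange_big /=; apply: eq_big_seq => a sa.
have aN : (maxn a.2.1 a.2.2 < N)%N by rewrite ltnS (big_rem a sa) /= leq_maxl.
have a1 : (a.2.1 < N)%N by apply: leq_ltn_trans aN; rewrite leq_maxl.
have a2 : (a.2.2 < N)%N by apply: leq_ltn_trans aN; rewrite leq_maxr.
pose t := (Ordinal a1, Ordinal a2).
have et : a.2 = bpos t by rewrite /bpos /=; case: a.2.
rewrite (bigD1 t) //= et eqxx big1 ?addr0 // => t' ne.
by case: (bpos t =P bpos t') => // /bpos_inj e; case/eqP: ne.
Qed.

(** * Ideals saturated with respect to [z] *)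

Section Ideal.
Variable I : R -> Prop.
Hypothesis I_ideal : two_sided_ideal I.
Hypothesis I_zK : forall r, I (r * z) -> I r.

Lemma idealMl r s : I s -> I (r * s).
Proof. by case: I_ideal => _ _ IM /(IM r)[]. Qed.

Lemma idealMr r s : I s -> I (s * r).
Proof. by case: I_ideal => _ _ IM /(IM r)[]. Qed.

Lemma idealZ c r : I r -> I (c *: r).
Proof. by rewrite -mulr_algl; apply: idealMl. Qed.

Lemma idealZK c r : c != 0 -> I (c *: r) -> I r.
Proof. by move=> c0 /(idealZ c^-1); rewrite scalerA mulVf ?scale1r. Qed.

Lemma ideal_zXK n r : I (r * z ^+ n) -> I r.
Proof. by elim: n r => [|n IH] r; rewrite ?mulr1 // exprS mulrA => /IH/I_zK. Qed.

Lemma ideal_yX : stable_simple alpha gamma ->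
  ~ (exists (c : A) (m j : int),
       ~ (m = 0 /\ j = 0) /\ special alpha gamma rho m j c) ->
  (exists r, I r /\ r <> 0) -> exists n, I (y ^+ n).
Proof.
move=> A_simple no_special [r [Ir r0]].
have [n0 /pspan_bev[N [f0 ef0]]] := pspan_yX r.
pose J (f : {ffun 'I_N * 'I_N -> A}) := exists n, I (bev f * y ^+ n).
have [|f g [m If] [n Ig]|a f [n If]|a f [n If]|f [n If]|f [n If]|||t [n]] :=
  @monomial_in_stable _ _ alpha gamma rho rho0 (ask_comm R) _
    (fun t : 'I_N * 'I_N => t.1 : nat) (fun t =>
      t.2 : nat) J _ _ _ _ _ _ A_simple no_special f0.
- exact: bpos_inj.
- exists (m + n)%N; rewrite bevB mulrBl; case: I_ideal => _ IB _; apply: IB.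
    by rewrite exprD mulrA; apply: idealMr.
  by rewrite addnC exprD mulrA; apply: idealMr.
- exists n; rewrite (_ : bev _ = i a * bev f); first by rewrite -mulrA;
  apply: idealMl.
  rewrite /bev mulr_sumr; apply: eq_bigr => t _.
  by rewrite ffunE rmorphM mulrA.
- exists n; rewrite (_ : bev _ = bev f * i a).
    by rewrite -mulrA in_yX mulrA; apply: idealMr.
  rewrite /bev mulr_suml; apply: eq_bigr => t _.
  by rewrite ffunE rmorphM -mulrA -[RHS]mulrA pmon_in.
(* Conjugation by [y] costs one more power of [y] on the right. *)
- exists n.+1; rewrite exprS mulrA (_ : bev _ * y = y * bev f).
    by rewrite -mulrA; apply: idealMl.
  rewrite /bev mulr_suml mulr_sumr; apply: eq_bigr => t _.
  by rewrite ffunE pmon_y y_pmon scalerA divff ?scale1r ?expf_neq0.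
(* Conjugation by [z]: a factor [z] is added on the right, moved past [y^n] at the cost of a scalar,
   and finally removed by saturation. *)
- exists n; apply: (@ideal_zXK 1); rewrite expr1 -mulrA.
  have := zX_yX R hu 1 n; rewrite mul1n expr1.
  move/(congr1 (fun t => rho ^- n *: t));
    rewrite scalerA mulVf ?expf_neq0 // scale1r => <-.
  rewrite -scalerAr; apply: idealZ; rewrite mulrA (_ : bev _ * z = z * bev f).
    by rewrite -mulrA; apply: idealMl.
  rewrite /bev mulr_suml mulr_sumr; apply: eq_bigr => t _.
  by rewrite ffunE pmon_z z_pmon.
- by exists 0%N; rewrite mulr1 -ef0; apply: idealMr.
- move=> f00; apply: r0; apply: (@yX_rregular _ _ _ _ _ _ R n0).
  by rewrite ef0 f00 /bev big1 // => t _; rewrite ffunE rmorph0 mul0r.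
have -> : bev [ffun s => (s == t)%:R] = pmon (bpos t).
  rewrite /bev (bigD1 t) //= ffunE eqxx rmorph1 mul1r big1 ?addr0 // => s /negPf e.
  by rewrite ffunE e rmorph0 mul0r.
(* The powers of [y] are gathered on the left, and saturation strips the power of [z]. *)
rewrite /pmon -mulrA (zX_yX R hu) -scalerAr mulrA => /idealZK It.
by exists (t.1 + n)%N; rewrite exprD; apply: (@ideal_zXK t.2); apply: It;
  apply: expf_neq0.
Qed.

Lemma ideal_descent : (forall m : nat, (1 <= m)%N ->
    exists (n : nat) (a : A), u ^+ n = v_sum alpha v rho m * a) ->
  forall n, I (y ^+ n) -> I 1.
Proof.
move=> u_nil; elim=> [|m IH] Iy; first by rewrite -(expr0 y).
apply: IH; have [n [a ea]] := u_nil m.+1 isT.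
have Iv : I (i (v_sum alpha v rho m.+1) * y ^+ m).
  have -> : i (v_sum alpha v rho m.+1) * y ^+ m =
      x * y ^+ m.+1 - rho ^+ m.+1 *: (y ^+ m.+1 * x).
    by rewrite x_yX addrAC subrr add0r.
  case: I_ideal => _ IB _; apply: IB; first exact: idealMl.
  by apply: idealZ; apply: idealMr.
have Iu : I (i (u ^+ n) * y ^+ m).
  by rewrite ea rmorphM -mulrA in_yX mulrA; apply: idealMr.
have Izu : I ((z + i u) * y ^+ m) by rewrite -x_yE -mulrA -exprS; apply: idealMl.
have uz l : i (u ^+ l) * z = z * i (u ^+ l).
  by rewrite (z_in R hu) [gamma _]rmorphXn /= (gamma_u hu).
(* Since [(z + u) y^m] lies in [I] and [u] commutes with [z], each factor [u] can be traded for
   [-z]; [k] varies because it grows as [l] drops. *)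
have Izuk l : forall k, I (z ^+ k * i (u ^+ l) * y ^+ m) ->
  I (z ^+ (l + k) * y ^+ m).
  elim: l => [|l IHl] k; first by rewrite expr0 rmorph1 mulr1.
  move=> Ik; rewrite addSnnS; apply: IHl.
  have -> : z ^+ k.+1 * i (u ^+ l) * y ^+ m =
      z ^+ k * i (u ^+ l) * ((z + i u) * y ^+ m) - z ^+ k * i (u ^+ l.+1) * y ^+ m.
    rewrite exprSr -(mulrA _ z) -uz mulrDl mulrDr exprSr rmorphM !mulrA.
    by rewrite addrK.
  by case: I_ideal => _ IB _; apply: IB => //; apply: idealMl.
have := Izuk n 0%N; rewrite mul1r addn0 (zX_yX R hu) => /(_ Iu).
by move/idealZK => /(_ (expf_neq0 _ rho0)) /ideal_zXK.
Qed.

End Ideal.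
End Simplicity.

(** * Necessity *)

Section Necessity.
Variables (F : fieldType) (A : algType F) (alpha gamma : algAut A).
Variables (v : A) (rho : F) (R : ambiskew alpha gamma v rho) (u : A).
Hypothesis hu : splitting_elt alpha gamma v rho u.

Local Notation i := (ask_in R).
Local Notation x := (ask_x R).
Local Notation y := (ask_y R).
Local Notation z := (casimir R u).
Local Notation Y := (ask_skew_y R).
Local Notation inB := (ask_skew_in R).
Local Notation oreB := (ask_skewP R).
Local Notation oreR := (ask_ringP R).
Local Notation deltaB := (@ask_delta _ _ _ _ _ _ R).
Local Notation pmon := (pmon R u).
Local Notation pev := (pev R u).
Local Notation bev := (@bev _ _ _ _ _ _ R u).
Let rho0 : rho != 0 := ask_rho_neq0 R.

Hypothesis z_simple : forall I : R -> Prop, two_sided_ideal I ->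
  (forall r, I r -> exists r', I r' /\ r * z = z * r') ->
  (exists r, I r /\ r <> 0) -> exists n, I (z ^+ n).

Lemma ask_in_inj a : i a = 0 -> a = 0.
Proof.
move=> a0; have s0 : pev [:: (a, (0, 0)%N)] = 0.
  by rewrite /pev big_seq1 a0 mul0r.
by have := pev_indep hu (0, 0)%N s0; rewrite big_cons big_nil eqxx addr0.
Qed.

Lemma stable_simple_of_z_simple : stable_simple alpha gamma.
Proof.
move=> I0 [I00 I0B I0M] I0a I0g.
case: (classic (exists a, I0 a /\ a <> 0)) => [[a0 [Ia0 a0n0]]|h]; last first.
  by left=> a Ia; apply: NNPP => a0; apply: h; exists a.
right.
have tK : cancel (alpha \o gamma) (aut_inv gamma \o aut_inv alpha).
  by move=> a /=; rewrite (aut_funK alpha) (aut_funK gamma).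
have tVK : cancel (aut_inv gamma \o aut_inv alpha) (alpha \o gamma).
  by move=> a /=; rewrite (aut_invK gamma) (aut_invK alpha).
pose theta : algAut A := @AlgAut F A (alpha \o gamma) _ tK tVK.
have thetaE a : theta a = alpha (gamma a) by [].
have agC := ask_comm R.
have thetaX_g n a : iter n theta (gamma a) = gamma (iter n theta a).
  by elim: n => //= n ->; rewrite agC.
have thetaX_a n a : iter n theta (alpha a) = alpha (iter n theta a).
  by elim: n => //= n ->; rewrite -agC.
have I0tX n a : I0 a -> I0 (iter n theta a).
  by elim: n => //= n IH /IH Ia; apply/I0a/I0g.
(* [I0] need not be mapped onto itself by alpha and gamma, but [I] is. *)
pose I a := exists n, I0 (iter n theta a).
have IB a b : I a -> I b -> I (a - b).
  move=> [m Ia] [n Ib]; exists (n + m)%N; rewrite iter_autD iter_autN.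
  by apply: I0B; [|rewrite addnC]; rewrite iterD; apply: I0tX.
have IMl r a : I a -> I (r * a).
  by move=> [n Ia]; exists n; rewrite iter_autM; case: (I0M (iter n theta r) _ Ia).
have IMr r a : I a -> I (a * r).
  by move=> [n Ia]; exists n; rewrite iter_autM; case: (I0M (iter n theta r) _ Ia).
have I0' : I 0 by exists 0%N.
have Ia a : I a -> I (alpha a).
  by move=> [n In]; exists n; rewrite thetaX_a; apply: I0a.
(* As [theta] sends [gamma^-1(a)] to [alpha(a)] and [beta(a)] to [gamma^2(a)], one more iterate
   clears the inverses here and in [Ib]. *)
have IgV a : I a -> I (aut_inv gamma a).
  move=> [n In]; exists n.+1; rewrite iterSr thetaE (aut_invK gamma) thetaX_a.
  exact: I0a.
have Ib a : I a -> I (beta alpha gamma a).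
  move=> [n In]; exists n.+1; rewrite iterSr thetaE agC alpha_beta !thetaX_g.
  exact/I0g/I0g.
(* The enlargement is harmless because [theta] fixes 1. *)
have I1 : I 1 -> forall a, I0 a.
  move=> [n]; rewrite iter_aut1 => I01 a.
  by case: (I0M a _ I01); rewrite mulr1.
apply: I1.
pose G r := exists a, I a /\ r = i a.
have Gl r s : right_span G s -> right_span G (r * s).
  elim/ambiskew_ind: r s => [r1 r2 h1 h2|r1 r2 h1 h2|a||] s hs.
  - by rewrite mulrDl; apply: right_spanD; [apply: h1|apply: h2].
  - by rewrite -mulrA; apply/h1/h2.
  - apply: right_spanMl hs => _ [b [Ib' ->]].
    rewrite -rmorphM -[X in right_span _ X]mulr1; apply: right_span_gen.
    by exists (a * b); split=> //; apply: IMl.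
  - apply: right_spanMl hs => _ [b [Ib' ->]]; rewrite y_in.
    by apply: right_span_gen; exists (alpha b); split=> //; apply: Ia.
  - apply: right_spanMl hs => _ [b [Ib' ->]]; rewrite x_in.
    by apply: right_span_gen; exists (beta alpha gamma b); split=> //; apply: Ib.
have G1 g : G g -> right_span G g by rewrite -{2}[g]mulr1; apply: right_span_gen.
have [|||n] := @z_simple (right_span G).
- by apply: right_span_ideal => r g /G1; apply: Gl.
- apply: right_span_norm => [s|_ [a [Ia' ->]]]; first exact: (z_normr hu).
  exists (i (aut_inv gamma a)); rewrite (z_in R hu) (aut_invK gamma); split=> //.
  by exists (aut_inv gamma a); split=> //; apply: IgV.
- exists (i a0); split; last by move=> /ask_in_inj.
  by apply: G1; exists a0; split=> //; exists 0%N.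
(* The coefficient of [Y^n x^n] in [z^n] is a nonzero scalar, while elements of the span have that
   coefficient in [I]. *)
have [k [k0 [e _]]] := zX_top R hu n.
have : forall r, right_span G r -> I (ore_coef oreB (ore_coef oreR r n) n).
  move=> r; elim=> [|_ s t [a [Ia' ->]] _ IH]; first by rewrite !ore_coef0.
  rewrite ore_coefD ore_coefD -[t]opprK ore_coefN ore_coefN.
  apply: (IB); first by rewrite !ore_coefZ; apply: IMr.
  by rewrite ore_coefN ore_coefN -sub0r; apply: IB.
move/[apply]; rewrite e ore_coefsc ore_coefXn eqxx.
by move/(IMl (k^-1)%:A); rewrite mulr_algl scalerA mulVf ?scale1r.
Qed.

(** * Special elements and non-invertible normal elements *)

Definition padd (p q : nat * nat) : nat * nat := (p.1 + q.1, p.2 + q.2)%N.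

Lemma padd_inj q : injective (padd q).
Proof. by move=> [a b] [c d] [] /addnI-> /addnI->. Qed.

Lemma pmonM q a p : pmon q * (i a * pmon p) =
  i (rho ^+ (q.2 * p.1) *: iter q.1 alpha (iter q.2 gamma a)) * pmon (padd q p).
Proof.
rewrite mulrA (pmon_in R hu) /pmon -!mulrA [z ^+ q.2 * (_ * _)]mulrA (zX_yX R hu).
by rewrite -!scalerAl -!scalerAr linearZ /= -scalerAl !exprD !mulrA.
Qed.

(* Compare the terms of extreme weight on the two sides of
   [(1 + "psi-monomial") * f = monomial]. *)
Lemma two_terms_no_monomial N (f : {ffun 'I_N * 'I_N -> A})
    (phi psi : 'I_N * 'I_N -> A -> A) p q r b (h : nat * nat -> nat) :
  (forall t, phi t 0 = 0) -> (forall t, psi t 0 = 0) ->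
  (forall t a, phi t a = 0 -> a = 0) -> (forall t a, psi t a = 0 -> a = 0) ->
  {morph h : s t / padd s t >-> (s + t)%N} ->
  \sum_t i (phi t (f t)) * pmon (padd p (bpos t)) +
    \sum_t i (psi t (f t)) * pmon (padd q (bpos t)) = i b * pmon r ->
  (h p < h q)%N -> f = 0.
Proof.
move=> phi0 psi0 phiI psiI hD E hpq.
pose s := [seq (phi t (f t), padd p (bpos t)) | t <- index_enum _] ++
  [seq (psi t (f t), padd q (bpos t)) | t <- index_enum _] ++ [:: (- b, r)].
have s0 : pev s = 0.
  rewrite /pev !big_cat !big_map /= big_seq1 rmorphN mulNr addrA.
  by apply/eqP; rewrite subr_eq0; apply/eqP.
have coef P : P <> r -> \sum_(t | padd p (bpos t) == P) phi t (f t) +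
    \sum_(t | padd q (bpos t) == P) psi t (f t) = 0.
  move=> /nesym/eqP Pr; have := pev_indep hu P s0.
  by rewrite !big_cat !big_map /= big_cons big_nil (negPf Pr) addr0.
apply: NNPP => fn0.
have [t0 ft0] : exists t, f t != 0.
  apply: NNPP => hf; apply: fn0; apply/ffunP => t; rewrite ffunE.
  by apply/eqP; apply: contraT => ft; case: hf; exists t.
have [t1 ft1 max1] := @arg_maxnP _ t0 (fun t => f t != 0) (fun t => h (bpos t)) ft0.
have [t2 ft2 min2] := @arg_minnP _ t0 (fun t => f t != 0) (fun t => h (bpos t)) ft0.
(* A [p]-term in the same position would come from a point of the support heavier than [t1], so
   nothing cancels this term; [e2] is dual. *)
have e1 : padd q (bpos t1) = r.
  apply: NNPP => /coef; rewrite big1 ?add0r => [|t /eqP /(congr1 h)]; last first.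
    rewrite !hD => eh; have [->|/max1 le] := eqVneq (f t) 0; first exact: phi0.
    by move: (leq_add hpq le); rewrite addSn eh ltnn.
  rewrite (big_pred1 t1) => [/psiI e|t]; first by rewrite e eqxx in ft1.
  by rewrite (inj_eq (@padd_inj q)) (inj_eq (@bpos_inj N)).
have e2 : padd p (bpos t2) = r.
  apply: NNPP => /coef; rewrite addrC big1 ?add0r => [|t /eqP /(congr1 h)];
    last first.
    rewrite !hD => eh; have [->|/min2 le] := eqVneq (f t) 0; first exact: psi0.
    by move: (leq_add hpq le); rewrite addSn eh ltnn.
  rewrite (big_pred1 t2) => [/phiI e|t]; first by rewrite e eqxx in ft2.
  by rewrite (inj_eq (@padd_inj p)) (inj_eq (@bpos_inj N)).
have := leq_add hpq (min2 _ ft1).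
have /(congr1 h) : padd p (bpos t2) = padd q (bpos t1) by rewrite e1 e2.
by rewrite !hD addSn => ->; rewrite ltnn.
Qed.

(** The element [e] is normal and commutes with [z], so [z_simple] puts some [z^n] in [e R], against
    the two distinct terms of [e]. The hypotheses are those of [specialP] with [k0 = 0]. *)
Lemma unit_special_false (c d : A) k l0 l : c * d = 1 -> d * c = 1 ->
  (k, l) <> (0, l0)%N -> rho ^+ k *: gamma c = c ->
  rho ^+ l0 *: alpha c = rho ^+ l *: c ->
  (forall a, iter l0 gamma a * c = c * iter k alpha (iter l gamma a)) -> False.
Proof.
move=> cd dc kl gc ac cn.
pose e : R := z ^+ l0 + i c * pmon (k, l).
have e_in a : i (iter l0 gamma a) * e = e * i a.
  rewrite mulrDr mulrDl (zX_in R hu) -[in RHS]mulrA (pmon_in R hu) !mulrA -!rmorphM.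
  by rewrite cn.
have in_e a : i a * e =
  e * i (iter l0 (aut_inv gamma) a) by rewrite -e_in iter_autK.
have e_y : e * y = rho ^+ l0 *: (y * e).
  rewrite mulrDl mulrDr scalerDr (zX_y R hu) pmon_y // y_pmon /=.
  by rewrite [rho ^+ l0 *: (i _ * _)]scalerAl -linearZ /= ac.
have e_z : e * z = z * e.
  rewrite mulrDl [z * e]mulrDr -exprSr -exprS pmon_z (z_pmon R hu) /=.
  by rewrite gc.
have e_x : x * e = rho ^+ l0 *: (e * x).
  (* Cancelling [y] on the right, it suffices that [e] commutes with [x y = z + u]; for [u] this
     uses [gamma u = u]. *)
  apply/eqP; rewrite -subr_eq0; apply/eqP; apply: (@y_rregular _ _ _ _ _ _ R).
  rewrite mulrBl -scalerAl -!mulrA e_y -scalerAr -scalerBr.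
  rewrite [x * (y * e)]mulrA (x_yE R u) [(z + i u) * e]mulrDl [e * (z + i
    u)]mulrDr e_z -e_in.
  suff -> : iter l0 gamma u = u by rewrite subrr scaler0.
  by elim: (l0) => //= n ->; rewrite (gamma_u hu).
have norm_e r : exists r', r * e = e * r'.
  elim/ambiskew_ind: r => [s t [s' es] [t' et]|s t [s' es] [t' et]|a||].
  - by exists (s' + t'); rewrite mulrDl es et mulrDr.
  - by exists (s' * t'); rewrite -mulrA et mulrA es -mulrA.
  - by exists (i (iter l0 (aut_inv gamma) a)).
  - exists (rho ^- l0 *: y).
    by rewrite -scalerAr e_y scalerA mulVf ?scale1r // expf_neq0.
  - by exists (rho ^+ l0 *: x); rewrite e_x scalerAr.
have [|||n [s es]] := @z_simple (fun r => exists s, r = e * s).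
- split; first by exists 0; rewrite mulr0.
    by move=> _ _ [s ->] [t ->]; exists (s - t); rewrite mulrBr.
  move=> r _ [s ->]; split; last by exists (s * r); rewrite mulrA.
  by have [r' er] := norm_e r; exists (r' * s); rewrite [LHS]mulrA er -[LHS]mulrA.
- move=> _ [s ->]; have [s' es] := z_normr hu s.
  by exists (e * s'); split; [exists s' | rewrite -mulrA es !mulrA e_z].
- exists e; split; first by exists 1; rewrite mulr1.
  move=> e0; have s0 : pev [:: (1, (0, l0)%N); (c, (k, l))] = 0.
    by rewrite /pev big_cons big_seq1 rmorph1 /pmon !mul1r.
  have := pev_indep hu (0, l0)%N s0; rewrite !big_cons big_nil eqxx /=.
  by case: eqP => // _ /eqP; rewrite addr0 oner_eq0.
(* Multiplying [z^n = e s] by [y^M] brings the cofactor into the span and leaves one monomial on the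
   other side. *)
have [M /pspan_bev[N [f ef]]] := pspan_yX hu s.
have Ef : e * bev f = i (rho ^+ (n * M) *: 1) * pmon (M, n).
  by rewrite -ef mulrA -es (zX_yX R hu) linearZ /= rmorph1 -scalerAl mul1r.
have f0 : f <> 0.
  move=> f0; have s0 : pev [:: (rho ^+ (n * M) *: 1, (M, n))] = 0.
    rewrite /pev big_seq1 -Ef f0 /bev big1 ?mulr0 // => t _.
    by rewrite ffunE rmorph0 mul0r.
  have := pev_indep hu (M, n) s0; rewrite big_cons big_nil eqxx addr0 => /eqP.
  by rewrite scaler_eq0 oner_eq0 orbF expf_eq0 (negPf rho0) andbF.
(* The coefficients produced by the two terms of [e]; invertibility of [c] makes [psi] injective. *)
pose phi (t : 'I_N * 'I_N) a := rho ^+ (l0 * t.1) *: iter l0 gamma a.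
pose psi (t : 'I_N * 'I_N) a :=
  c * (rho ^+ (l * t.1) *: iter k alpha (iter l gamma a)).
have phi0 t : phi t 0 = 0 by rewrite /phi iter_aut0 scaler0.
have psi0 t : psi t 0 = 0 by rewrite /psi !iter_aut0 scaler0 mulr0.
have phiI t a : phi t a = 0 -> a = 0.
  move/eqP; rewrite scaler_eq0 expf_eq0 (negPf rho0) andbF => /eqP.
  by rewrite -[0 in RHS](iter_aut0 gamma l0) => /iter_aut_inj.
have psiI t a : psi t a = 0 -> a = 0.
  move/(congr1 (fun b => d * b)); rewrite mulrA dc mul1r mulr0 => /eqP.
  rewrite scaler_eq0 expf_eq0 (negPf rho0) andbF => /eqP.
  rewrite -[0 in RHS](iter_aut0 alpha k) => /iter_aut_inj.
  by rewrite -[0 in RHS](iter_aut0 gamma l) => /iter_aut_inj.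
have E : \sum_t i (phi t (f t)) * pmon (padd (0, l0)%N (bpos t)) +
    \sum_t i (psi t (f t)) * pmon (padd (k, l) (bpos t)) =
    i (rho ^+ (n * M) *: 1) * pmon (M, n).
  rewrite -Ef mulrDl /bev !mulr_sumr; congr (_ + _); apply: eq_bigr => t _.
    have -> : z ^+ l0 = pmon (0, l0)%N by rewrite /pmon mul1r.
    by rewrite pmonM.
  by rewrite -mulrA pmonM mulrA -rmorphM.
have h1D : {morph (fun p : nat * nat => p.1) : s t / padd s t >-> (s + t)%N} by [].
have h2D : {morph (fun p : nat * nat => p.2) : s t / padd s t >-> (s + t)%N} by [].
(* The weight is the exponent of [y] if [k > 0]; otherwise it is that of [z], where [l] and [l0]
   differ. *)
apply: f0; have [k0|k_gt0] := posnP k; last first.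
  exact: (two_terms_no_monomial phi0 psi0 phiI psiI h1D E k_gt0).
have [lt_l|lt_l|el] := ltngtP l l0.
- rewrite addrC in E.
  exact: (two_terms_no_monomial psi0 phi0 psiI phiI h2D E lt_l).
- exact: (two_terms_no_monomial phi0 psi0 phiI psiI h2D E lt_l).
- by case: kl; rewrite k0 el.
Qed.

Lemma no_special_of_z_simple : ~ (exists (c : A) (m j : int),
  ~ (m = 0 /\ j = 0) /\ special alpha gamma rho m j c).
Proof.
move=> [c [m [j [mj c_special]]]].
have [c0 gc ac [cn _]] := c_special.
have agC := ask_comm R.
have gaC a : gamma (alpha a) = alpha (gamma a) by rewrite agC.
have A_simple := stable_simple_of_z_simple.
pose th a := aut_expz alpha m (aut_expz gamma (- j) a).
pose thV a := aut_expz gamma j (aut_expz alpha (- m) a).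
have thK a : th (thV a) = a.
  have e b : aut_expz gamma (- j) (aut_expz gamma j b) = b.
    by rewrite -{2}[j]opprK aut_expzV.
  by rewrite /th /thV e aut_expzV.
have cthV a : a * c = c * thV a by rewrite cn -/(th _) thK.
(* By normality and the eigenvalue equations [c A] is an {alpha, gamma}-ideal containing [c], hence
   all of [A]. *)
have [d cd] : exists d, c * d = 1.
  case: (A_simple (fun a => exists b, a = c * b)) =>
    [|_ [b ->]|_ [b ->]|h|/(_ 1)[d]].
  - split; first by exists 0; rewrite mulr0.
      by move=> _ _ [a ->] [b ->]; exists (a - b); rewrite mulrBr.
    move=> r _ [a ->]; split; last by exists (a * r); rewrite mulrA.
    by exists (thV r * a); rewrite !mulrA cthV.
  - by exists (rho ^ j *: alpha b); rewrite rmorphM /= ac -scalerAl scalerAr.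
  - by exists (rho ^ m *: gamma b); rewrite rmorphM /= gc -scalerAl scalerAr.
  - by case: c0; apply: h; exists 1; rewrite mulr1.
  - by move=> e; exists d.
have dc : d * c = 1.
  have [b bc] : exists b, b * c = 1.
    by exists (th d); rewrite /th -cn cd.
  by rewrite -[d]mul1r -bc -(mulrA b) cd mulr1 bc.
have d0 : d <> 0 by move=> d0; case: c0; rewrite -[c]mulr1 -cd d0 !mulr0.
have inv_eigen (f : algAut A) n : f c = rho ^ n *: c -> f d = rho ^ (- n) *: d.
  move=> fc; have : rho ^ n *: (c * f d) = 1.
    by rewrite scalerAl -fc -rmorphM cd rmorph1.
  move/(congr1 (fun a => rho ^ (- n) *: (d * a))).
  rewrite -scalerAr scalerA -expfzDr // addNr expr0z scale1r mulrA dc mul1r.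
  by rewrite mulr1.
have d_special : special alpha gamma rho (- m) (- j) d.
  have dthV a : d * a = thV a * d.
    by rewrite -[RHS]mul1r -dc -!mulrA; congr (d * _);
      rewrite mulrA -cthV -mulrA cd mulr1.
  have dn a : d * a = aut_expz alpha (- m) (aut_expz gamma (- - j) a) * d.
    by rewrite dthV opprK /thV (aut_expz_comm _ _ gaC).
  split; [by [] | exact: inv_eigen | exact: inv_eigen | split=> //].
  have d_unit a b : a * d = b * d -> a = b.
    by move/(congr1 (fun t => t * c)); rewrite -!mulrA dc !mulr1.
  by apply: d_unit; rewrite -dn.
(* Either c or its inverse has a nonpositive first weight. *)
have [b [b' [k [j' [bb' b'b kj b_special]]]]] : exists b b' (k : nat) (j' : int),
    [/\ b * b' = 1, b' * b = 1, ~ (k = 0%N /\ j' = 0) &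
        special alpha gamma rho (0%N%:Z - k%:Z) j' b].
  case: m mj c_special d_special {gc cn th thV thK cthV} =>
    n mj c_special d_special.
    exists d, c, n, (- j); rewrite sub0r; split=> //.
    by case=> n0 /eqP; rewrite oppr_eq0 => /eqP j0; apply: mj; rewrite n0 j0.
  by exists c, d, n.+1, j; rewrite sub0r -NegzE; split=> //; case.
have [l [l0 ej']] : exists l l0 : nat, j' = l%:Z - l0%:Z.
  by case: (j') => n; [exists n, 0%N; rewrite subr0 | exists 0%N, n.+1;
    rewrite sub0r -NegzE].
rewrite ej' in kj b_special.
have [_ gb ab bn] := (specialP rho0 agC _ _ _ _ _).1 b_special.
rewrite expr0 scale1r in gb.
apply: (unit_special_false bb' b'b _ gb ab bn).
by case=> k0 ll0; apply: kj; rewrite k0 ll0 subrr.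
Qed.

(** * Powers of [u] in the ideal generated by [v^(m)] *)

Lemma v_sumE m : v_sum alpha v rho m = u - rho ^+ m *: iter m alpha u.
Proof.
rewrite /v_sum; elim: m => [|m IH].
  by rewrite big_geq // scale1r subrr.
(* The sum telescopes once [v] is replaced by [u - rho alpha(u)]. *)
rewrite big_nat_recr //= IH {1}(vE hu) iter_autD iter_autN iter_autZ scalerBr
  addrA subrK.
by rewrite scalerA -exprSr -iterS iterSr.
Qed.

Lemma iter_alpha_gamma n a : iter n alpha (gamma a) = gamma (iter n alpha a).
Proof. exact: (iter_comm (ask_comm R) n 1). Qed.

Section Descent.
Variable m : nat.
Let V := v_sum alpha v rho m.+1.

Definition v_ideal a := exists b, a = V * b.

Lemma gamma_V : gamma V = V.
Proof.
rewrite /V v_sumE rmorphB; congr (_ - _); first exact: (gamma_u hu).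
by rewrite /= linearZ; congr (_ *: _);
  rewrite -{2}(gamma_u hu) -iterS -iterS iter_alpha_gamma.
Qed.

(** Both [u] and [alpha^(m+1)(u)] satisfy this relation, as [alpha] and [gamma] commute. It makes
    [V A] a two-sided ideal. *)
Lemma V_norm a : V * a = gamma a * V.
Proof.
rewrite /V v_sumE mulrBl mulrBr -(u_norm hu) -scalerAl -scalerAr.
have -> // : iter m.+1 alpha u * a = gamma a * iter m.+1 alpha u.
rewrite -{1}(iter_autK alpha m.+1 a) -iter_autM (u_norm hu) iter_autM.
by rewrite iter_alpha_gamma iter_autK.
Qed.

Lemma v_ideal0 : v_ideal 0.
Proof. by exists 0; rewrite mulr0. Qed.

Lemma v_idealD a b : v_ideal a -> v_ideal b -> v_ideal (a + b).
Proof. by move=> [c ->] [d ->]; exists (c + d); rewrite mulrDr. Qed.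

Lemma v_idealMr a b : v_ideal a -> v_ideal (a * b).
Proof. by move=> [c ->]; exists (c * b); rewrite mulrA. Qed.

Lemma v_idealMl a b : v_ideal a -> v_ideal (b * a).
Proof.
move=> [c ->]; exists (aut_inv gamma b * c).
by rewrite !mulrA V_norm (aut_invK gamma).
Qed.

Lemma v_ideal_gamma a : v_ideal a -> v_ideal (gamma a).
Proof. by move=> [c ->]; exists (gamma c); rewrite rmorphM /= gamma_V. Qed.

(* R / R x is A[y; alpha], on which x acts as deltaB; [descent_mod] is its
   submodule generated by V y^m and y^(m + 1). *)
Definition descent_mod b := forall k, (k <= m)%N ->
  v_ideal (iter (m - k) alpha (ore_coef oreB b k)).

Lemma skew_delta_coef b k : ore_coef oreB (deltaB b) k =
  beta alpha gamma (ore_coef oreB b k.+1) * v_sum alpha v rho k.+1.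
Proof.
have [N bN] := ore_finite oreB b.
have {1}-> : b = \sum_(j < N.+1) inB (ore_coef oreB b j) * Y ^+ j.
  by apply: ore_expand => n /ltnW; apply: bN.
rewrite (big_morph deltaB (ore_derivD oreR) (ore_deriv0 oreR)) ore_coef_sum.
have dE j : ore_coef oreB (deltaB (inB (ore_coef oreB b j) * Y ^+ j)) k =
    beta alpha gamma (ore_coef oreB b j) *
      (if j is n.+1 then v_sum alpha v rho n.+1 *+ (k == n) else 0).
  rewrite (ore_derivM oreR) ask_delta_A mul0r addr0 ask_beta_A ore_coefZ.
  congr (_ * _); case: j => [|n].
    have -> : deltaB (Y ^+ 0) = 0 by rewrite expr0 -(rmorph1 inB) ask_delta_A.
    by rewrite ore_coef0.
  by rewrite skew_delta_yX ore_coefZ ore_coefXn mulr_natr.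
under eq_bigr => j _ do rewrite dE.
rewrite big_ord_recl mulr0 add0r.
have [lt_kN|le_Nk] := ltnP k N.
  rewrite (bigD1 (Ordinal lt_kN)) //= eqxx mulr1n big1 ?addr0 // => j.
  by rewrite -val_eqE /= eq_sym => /negPf->; rewrite mulr0.
rewrite bN; last exact: leqW.
rewrite big1 => [|j _]; first by rewrite /beta rmorph0 autV0 mul0r.
by rewrite /= gtn_eqF ?mulr0 // (leq_trans (ltn_ord j)).
Qed.

Lemma descent_modD a b : descent_mod a -> descent_mod b -> descent_mod (a + b).
Proof.
by move=> ha hb k km; rewrite ore_coefD iter_autD; apply: v_idealD;
  [apply: ha|apply: hb].
Qed.

(** The coefficient of [x^0] is the class modulo [R x]. The action of [y] raises the degree and
    applies [alpha], matching the drop of [m - k]. That of [x] lowers the degree and applies [beta],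
    and [alpha beta = gamma] preserves [V A]; in degree [m] it produces the factor [V]. *)
Lemma descent_mod_left t r : descent_mod (ore_coef oreR r 0) ->
  descent_mod (ore_coef oreR (t * r) 0).
Proof.
elim/ambiskew_ind: t r => [s t hs ht|s t hs ht|a||] r hr.
- by rewrite mulrDl ore_coefD; apply: descent_modD; [apply: hs|apply: ht].
- by rewrite -mulrA; apply/hs/ht.
- move=> k km; rewrite ore_coefZ ore_coefZ iter_autM; apply: v_idealMl; exact: hr.
- move=> k km; rewrite ore_coefZ ore_coefXM addr0; case: k km => [|k] km.
    by rewrite rmorph0 iter_aut0; apply: v_ideal0.
  by rewrite -iterSr -subSn //; apply: hr; apply: ltnW.
- move=> k; rewrite ore_coefXM rmorph0 add0r skew_delta_coef iter_autM.
  rewrite leq_eqVlt => /predU1P[->|km].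
    by rewrite subnn /=; apply: v_idealMl; exists 1; rewrite mulr1.
  apply: v_idealMr; rewrite -(subnSK km) iterSr alpha_beta.
  by rewrite iter_alpha_gamma; apply: v_ideal_gamma; apply: hr.
Qed.

Lemma skew_yX_coef n b k : (k < n)%N -> ore_coef oreB (Y ^+ n * b) k = 0.
Proof.
elim: n k => // n IH k kn; rewrite exprS -mulrA ore_coefXM addr0.
by case: k kn => [|k] kn; rewrite /= ?IH ?rmorph0.
Qed.

(** Since [deltaB] kills [A], the term [rho y x] of [z] contributes nothing when acting on [A]
    modulo [R x]. *)
Lemma casimirX_coef0 n :
  ore_coef oreR (z ^+ n) 0 = inB ((- (rho *: alpha u)) ^+ n).
Proof.
elim: n => [|n IH]; first by rewrite !expr0 ore_coef1 (rmorph1 inB).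
have -> : z ^+ n.+1 = rho *: (y * (x * z ^+ n)) - rho *: (i (alpha u) * z ^+ n).
  by rewrite exprS {1}(casimirE R hu) mulrBl -!scalerAl mulrA.
rewrite ore_coefD ore_coefN !ore_coefsc ore_coefZ ore_coefXM IH ask_delta_A.
rewrite rmorph0 addr0 mulr0 scaler0 add0r ore_coefZ IH.
rewrite [in RHS]exprS mulNr -scalerAl rmorphN; congr (- _).
by rewrite -rmorphM -linearZ.
Qed.

Lemma power_in_v_ideal : exists n, v_ideal (u ^+ n).
Proof.
pose G (g : R) := exists r, g = r * y ^+ m.+1.
have [|||n zn] := @z_simple (right_span G).
- apply: right_span_ideal => r _ [s ->]; rewrite mulrA -[_ * _ ^+ _]mulr1.
  by apply: right_span_gen; exists (r * s).
- apply: right_span_norm => [r|_ [r ->]]; first exact: (z_normr hu).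
  have [s es] := z_normr hu r; exists (rho ^- m.+1 *: s * y ^+ m.+1).
  split; first by exists (rho ^- m.+1 *: s).
  have := zX_yX R hu 1 m.+1; rewrite mul1n expr1.
  move/(congr1 (fun t => rho ^- m.+1 *: t));
    rewrite scalerA mulVf ?expf_neq0 // scale1r.
  by rewrite -mulrA => <-; rewrite -scalerAr -!scalerAl -scalerAr !mulrA es.
- exists (y ^+ m.+1); split.
    by rewrite -[y ^+ _]mulr1; apply: right_span_gen; exists 1; rewrite mul1r.
  rewrite -[y ^+ _]mul1r => /yX_rregular/eqP.
  by rewrite -(rmorph1 i) => /eqP/ask_in_inj/eqP; rewrite oner_eq0.
(* By [descent_mod_left] only [y^(m+1) s] matters, and its class has no coefficient in degrees at
   most [m]. *)
have spanN r : right_span G r -> descent_mod (ore_coef oreR r 0).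
  elim=> [k _|_ s t [r' ->] _ IH]; first by rewrite !ore_coef0 iter_aut0;
    apply: v_ideal0.
  rewrite ore_coefD; apply: descent_modD => //; rewrite -mulrA;
    apply: descent_mod_left.
  move=> k km; rewrite /ask_y -rmorphXn ore_coefZ skew_yX_coef ?iter_aut0 //.
  exact: v_ideal0.
exists n; have := spanN _ zn 0%N isT.
rewrite casimirX_coef0 ore_coef_in eqxx subn0 => Kn.
pose w := rho ^+ m.+1 *: iter m.+1 alpha u.
have uw : u = V + w by rewrite /V v_sumE subrK.
have Kw : v_ideal (w ^+ n).
  (* Applying [alpha^m] to [-rho alpha(u)] gives [-rho alpha^(m+1)(u)], which differs from [w] by
     the factor [-rho^m]. *)
  have -> : w ^+ n = ((- rho ^+ m) ^+ n)%:A * iter m alpha ((- (rho *: alpha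
    u)) ^+ n).
    have iterX k a : iter m alpha (a ^+ k) = iter m alpha a ^+ k.
      by elim: k => [|k IH]; rewrite ?iter_aut1 // !exprS iter_autM IH.
    rewrite iterX mulr_algl -exprZn; congr (_ ^+ n).
    by rewrite iter_autN iter_autZ -iterSr scalerN scaleNr opprK scalerA -exprSr.
  exact: v_idealMl.
suff : forall k, v_ideal (u ^+ k - w ^+ k).
  by move=> /(_ n) /v_idealD /(_ Kw); rewrite subrK.
elim=> [|k IH]; first by rewrite subrr; apply: v_ideal0.
(* Powers of [u] and [w] agree modulo [V A] because [u - w = V]. *)
have -> : u ^+ k.+1 - w ^+ k.+1 = u ^+ k * V + (u ^+ k - w ^+ k) * w.
  by rewrite mulrBl addrA -mulrDr -uw !exprSr.
by apply: v_idealD; [apply: v_idealMl; exists 1; rewrite mulr1 | apply: v_idealMr].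
Qed.

End Descent.
End Necessity.

Theorem theorem4p7 (F : fieldType) (A : algType F) (alpha gamma : algAut A)
    (v : A) (rho : F) (R : ambiskew alpha gamma v rho)
    (u : A) (hu : splitting_elt alpha gamma v rho u)
    (S : pzRingType) (phi : {rmorphism R -> S})
    (hS : localization (powers (casimir R u)) phi) :
  simple_ring S <->
  [/\ stable_simple alpha gamma,
      ~ (exists (c : A) (m j : int),
           ~ (m = 0 /\ j = 0) /\ special alpha gamma rho m j c)
    & forall m : nat, (1 <= m)%N ->
        exists (n : nat) (a : A), u ^+ n = v_sum alpha v rho m * a].
Proof.
have z_reg := z_rregular (R := R) hu.
have z_nr := z_normr (R := R) hu.
split=> [S_simple|[A_simple no_special u_pow]].
  have z_simple I := @simple_loc_power R S _ phi hS z_reg z_nr I S_simple.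
  split; [exact: (stable_simple_of_z_simple hu z_simple) |
          exact: (no_special_of_z_simple hu z_simple) |].
  (* The index is shifted: [power_in_v_ideal] at [m] concerns [v^(m+1)]. *)
  by case=> // m _; apply: (power_in_v_ideal hu z_simple).
apply: (simple_loc_intro hS z_reg) => [|I I_ideal I_zK I_n0].
  by apply/eqP; rewrite oner_eq0.
have [n In] := ideal_yX hu I_ideal I_zK A_simple no_special I_n0.
exact: (ideal_descent hu I_ideal I_zK u_pow In).
Qed.
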